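(* Let $\mathbf{R}=\{R_i,t_i\}_{i\ge0}$ be a preperfectoid tower arising from a pair $(R,I_0)$, and let $R\to S$ be a weakly étale homomorphism of rings. Then $\mathbf{R}\otimes_RS=\{R_i\otimes_RS,\ t_i\otimes_RS\}_{i\ge0}$ is a preperfectoid tower arising from $(S,I_0S)$.
   Context: All rings are commutative and unital. $p$ is a fixed prime. A pair $(A,I)$ is a ring $A$ with an ideal $I$. A ring homomorphism $A\to B$ is weakly étale if it is flat and the multiplication map $B\otimes_AB\to B$ is flat. A tower of rings is an inductive system of rings $\mathbf{R}=\{R_i,t_i\colon R_i\to R_{i+1}\}_{i\ge0}$ indexed by $\mathbb{N}$. For a ring $A$, an ideal $I\subset A$ and an $A$-module $M$, an element $x\in M$ is $I$-torsion if for every $a\in I$ there is $n>0$ with $a^nx=0$; $M_{I\text{-tor}}$ is the submodule of $I$-torsion elements. Let $\varphi_{I,M}\colon M_{I\text{-tor}}\hookrightarrow M\twoheadrightarrow M/IM$ be the natural composite. $\varphi$ denotes the absolute Frobenius $x\mapsto x^p$ of an $\mathbb{F}_p$-algebra. Let $(R,I_0)$ be a pair and $\mathbf{R}=\{R_i,t_i\}_{i\ge0}$ a tower of rings. $\mathbf{R}$ is a preperfectoid tower arising from $(R,I_0)$ if: (a) $R_0=R$ and $p\in I_0$. (b) For every $i\ge0$, the ring homomorphism $\overline{t_i}\colon R_i/I_0R_i\to R_{i+1}/I_0R_{i+1}$ induced by $t_i$ is injective. (c) For every $i\ge0$, $\mathrm{Im}(\varphi_{R_{i+1}/I_0R_{i+1}})\subset\mathrm{Im}(\overline{t_i})$.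 (Given (a)–(c), there is a unique ring homomorphism $F_i\colon R_{i+1}/I_0R_{i+1}\to R_i/I_0R_i$ with $\overline{t_i}\circ F_i=\varphi$, called the $i$-th Frobenius projection.) (d) For every $i\ge0$, $F_i$ is surjective. (f) $I_0$ is principal, and $R_1$ contains a principal ideal $I_1$ such that $I_1^p=I_0R_1$ and, for every $i\ge0$, $\mathrm{Ker}(F_i)=I_1(R_{i+1}/I_0R_{i+1})$. (g) For every $i\ge0$, $I_0(R_i)_{I_0\text{-tor}}=(0)$, and there exists a bijection $(F_i)_{\mathrm{tor}}\colon(R_{i+1})_{I_0\text{-tor}}\to(R_i)_{I_0\text{-tor}}$ such that $F_i\circ\varphi_{I_0,R_{i+1}}=\varphi_{I_0,R_i}\circ(F_i)_{\mathrm{tor}}$. (The tower $\mathbf{R}\otimes_RS$ has $0$-th layer $R_0\otimes_RS=S$.) *)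

(* Defs.v *)
From HB Require Import structures.
From mathcomp Require Import all_boot all_order all_algebra.
From mathcomp Require Import boolp classical_sets functions.

Set Implicit Arguments.
Unset Strict Implicit.
Unset Printing Implicit Defensive.

Import GRing.Theory.
Local Open Scope ring_scope.
Local Open Scope classical_set_scope.
Local Open Scope quotient_scope.

(* Rings are [comPzRingType]s: commutative, unital, possibly zero.  For the
   same reason ideals are allowed to be the whole ring, which rules out
   [idealr] from ring_quotient. *)

Section Ideals.
Variable A : comPzRingType.

Definition is_ideal (I : set A) : Prop :=
  [/\ I 0, forall x y, I x -> I y -> I (x + y) & forall a x, I x -> I (a * x)].

Record ideal := Ideal { ideal_set :> set A; idealP : is_ideal ideal_set }.

Lemma smallest_is_ideal (X : set A) : is_ideal (smallest is_ideal X).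
Proof.
split=> [J [[]]//|x y Hx Hy J HJ|a x Hx J HJ].
  by case: (HJ) => -[_ + _] _; apply; [exact: Hx|exact: Hy].
by case: (HJ) => -[_ _ +] _; apply; exact: Hx.
Qed.

Definition ideal_gen (X : set A) : ideal := Ideal (smallest_is_ideal X).

Definition principal (I : ideal) : Prop :=
  exists a, I = ideal_gen [set a] :> set A.

Definition ideal_unit : ideal := ideal_gen [set 1].

Definition ideal_mul (I J : ideal) : ideal :=
  ideal_gen [set x * y | x in I & y in J].

Definition ideal_exp (I : ideal) (n : nat) : ideal :=
  iter n (ideal_mul I) ideal_unit.

End Ideals.

Definition ideal_ext (A B : comPzRingType) (f : {rmorphism A -> B})
  (I : ideal A) : ideal B := ideal_gen (f @` I).

Section QuotientRing.
Variables (A : comPzRingType) (I : ideal A).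

Definition ideal_pred : {pred A} := mem (ideal_set I).

Lemma in_ideal_pred x : (x \in ideal_pred) = `[< ideal_set I x >].
Proof. by []. Qed.

Lemma ideal_zmod_closed : zmod_closed ideal_pred.
Proof.
case: (idealP I) => I0 ID IM; split=> [|x y]; rewrite !in_ideal_pred.
  exact/asboolP.
move=> /asboolP Ix /asboolP Iy; apply/asboolP/ID => //.
by rewrite -mulN1r; apply: IM.
Qed.

HB.instance Definition _ :=
  GRing.isZmodClosed.Build A ideal_pred ideal_zmod_closed.

Definition quot : Type := {ideal_quot ideal_pred}.

HB.instance Definition _ := EqQuotient.on quot.
HB.instance Definition _ := GRing.Zmodule.on quot.

Definition quot_proj (x : A) : quot := \pi x.

Lemma quot_projP x y : quot_proj x = quot_proj y <-> ideal_set I (x - y).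
Proof.
rewrite /quot_proj; split => [/eqP|Ixy].
  by rewrite -[_ == _]Quotient.idealrBE in_ideal_pred => /asboolP.
by apply/eqP; rewrite -[_ == _]Quotient.idealrBE in_ideal_pred; apply/asboolP.
Qed.

Lemma quot_reprK (x : quot) : quot_proj (repr x) = x.
Proof. exact: reprK. Qed.

Lemma quot_projB : zmod_morphism quot_proj.
Proof. by move=> x y; rewrite /quot_proj -[LHS]/(\pi_quot _) !raddfB. Qed.

Definition quot_mul (x y : quot) : quot := quot_proj (repr x * repr y).

Lemma quot_projM : {morph quot_proj : x y / x * y >-> quot_mul x y}.
Proof.
move=> x y; apply/quot_projP.
set x' := repr _; set y' := repr _.
have /quot_projP Ix : quot_proj x = quot_proj x' by rewrite quot_reprK.
have /quot_projP Iy : quot_proj y = quot_proj y' by rewrite quot_reprK.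
case: (idealP I) => _ ID IM.
have -> : x * y - x' * y' = y * (x - x') + x' * (y - y').
  by rewrite !mulrBr (mulrC y x) (mulrC y x') addrA subrK.
by apply: ID; apply: IM.
Qed.

Lemma quot_mulA : associative quot_mul.
Proof.
move=> x y z; rewrite -[x]quot_reprK -[y]quot_reprK -[z]quot_reprK.
by rewrite -!quot_projM mulrA.
Qed.

Lemma quot_mulC : commutative quot_mul.
Proof. by move=> x y; rewrite /quot_mul mulrC. Qed.

Lemma quot_mul1 : left_id (quot_proj 1) quot_mul.
Proof. by move=> x; rewrite -[x]quot_reprK -quot_projM mul1r. Qed.

Lemma quot_projD : {morph quot_proj : x y / x + y >-> x + y}.
Proof. by move=> x y; rewrite /quot_proj -[LHS]/(\pi_quot _) !raddfD. Qed.

Lemma quot_mulDl : left_distributive quot_mul +%R.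
Proof.
move=> x y z; rewrite -[x]quot_reprK -[y]quot_reprK -[z]quot_reprK.
by rewrite -quot_projD -!quot_projM -quot_projD mulrDl.
Qed.

HB.instance Definition _ := GRing.Zmodule_isComPzRing.Build quot
  quot_mulA quot_mulC quot_mul1 quot_mulDl.

HB.instance Definition _ :=
  GRing.isZmodMorphism.Build A quot quot_proj quot_projB.
HB.instance Definition _ :=
  GRing.isMonoidMorphism.Build A quot quot_proj (erefl, quot_projM).

End QuotientRing.

(* A / I A, for an R-algebra f : R -> A and an ideal I of R. *)
Section Modulo.
Variables (R A : comPzRingType) (f : {rmorphism R -> A}) (I : ideal R).

Definition modulo : comPzRingType := quot (ideal_ext f I).

Definition modulo_proj : {rmorphism A -> modulo} := @quot_proj _ (ideal_ext f I).

End Modulo.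

Section ModuloMap.
Variables (R A B : comPzRingType) (f : {rmorphism R -> A}) (I : ideal R).
Variable u : {rmorphism A -> B}.

Local Notation uf := (u \o f : {rmorphism R -> B}).

Definition modulo_map (x : modulo f I) : modulo uf I :=
  modulo_proj uf I (u (repr x)).

Lemma ideal_ext_comp x : ideal_set (ideal_ext f I) x ->
  ideal_set (ideal_ext uf I) (u x).
Proof.
move=> Ix J [JI uIJ]; apply: (Ix (u @^-1` J)).
case: JI => J0 JD JM; split; last by move=> _ [a Ia <-]; apply: uIJ; exists a.
split=> [|a b|a b] /=; rewrite ?raddf0 ?raddfD ?rmorphM //.
- exact: JD.
- exact: JM.
Qed.

Lemma modulo_mapE x : modulo_map (modulo_proj f I x) = modulo_proj uf I (u x).
Proof.
apply/quot_projP; rewrite -raddfB; apply: ideal_ext_comp; apply/quot_projP.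
exact: quot_reprK.
Qed.

Lemma modulo_map_zmod_morphism : zmod_morphism modulo_map.
Proof.
move=> x y; rewrite -[x]quot_reprK -[y]quot_reprK.
by rewrite -raddfB !modulo_mapE !raddfB.
Qed.

Lemma modulo_map_monoid_morphism : monoid_morphism modulo_map.
Proof.
split=> [|x y]; first by rewrite -(rmorph1 (modulo_proj f I)) modulo_mapE !rmorph1.
rewrite -[x]quot_reprK -[y]quot_reprK.
by rewrite -rmorphM !modulo_mapE !rmorphM.
Qed.

HB.instance Definition _ := GRing.isZmodMorphism.Build (modulo f I)
  (modulo uf I) modulo_map modulo_map_zmod_morphism.
HB.instance Definition _ := GRing.isMonoidMorphism.Build (modulo f I)
  (modulo uf I) modulo_map modulo_map_monoid_morphism.

End ModuloMap.

(* The tensor product of modules: formal finite sums of pairs (m, n), read as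
   sums of pure tensors, modulo the congruence generated by the commutativity
   of addition and the bilinearity relations.  The relation [tensor_rel0]
   cannot be omitted because formal sums only form a monoid; negatives are
   then given by (- m, n). *)
Section Tensor.
Variables (A : comPzRingType) (M N : lmodType A).

Inductive tensor_rel : seq (M * N) -> seq (M * N) -> Prop :=
| tensor_rel_refl s : tensor_rel s s
| tensor_rel_sym s t : tensor_rel s t -> tensor_rel t s
| tensor_rel_trans s t r : tensor_rel s t -> tensor_rel t r -> tensor_rel s r
| tensor_rel_cat s s' t t' :
    tensor_rel s s' -> tensor_rel t t' -> tensor_rel (s ++ t) (s' ++ t')
| tensor_rel_catC s t : tensor_rel (s ++ t) (t ++ s)
| tensor_rel0 n : tensor_rel [:: (0, n)] [::]
| tensor_relDl m m' n : tensor_rel [:: (m + m', n)] [:: (m, n); (m', n)]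
| tensor_relDr m n n' : tensor_rel [:: (m, n + n')] [:: (m, n); (m, n')]
| tensor_relZ a m n : tensor_rel [:: (a *: m, n)] [:: (m, a *: n)].

Definition tensor_eq (s t : seq (M * N)) : bool := `[< tensor_rel s t >].

Lemma tensor_eq_class : equiv_class_of tensor_eq.
Proof.
split=> [s|s t|t s r].
- exact/asboolP/tensor_rel_refl.
- by apply/asboolP/asboolP; apply: tensor_rel_sym.
- move=> /asboolP st /asboolP tr; apply/asboolP; exact: tensor_rel_trans st tr.
Qed.

Canonical tensor_equiv := EquivRelPack tensor_eq_class.
Canonical tensor_encModRel := defaultEncModRel tensor_eq.

Definition tensor : Type := {eq_quot tensor_eq}.

HB.instance Definition _ := EqQuotient.on tensor.
HB.instance Definition _ := Choice.on tensor.

Definition tensor_sum (s : seq (M * N)) : tensor := \pi s.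

Lemma tensor_sumP s t : tensor_sum s = tensor_sum t <-> tensor_rel s t.
Proof.
rewrite /tensor_sum; split=> [/eqquotP/asboolP//|st].
exact/eqquotP/asboolP.
Qed.

Lemma tensor_sum_reprK (x : tensor) : tensor_sum (repr x) = x.
Proof. exact: reprK. Qed.

Definition tensor_add (x y : tensor) : tensor := tensor_sum (repr x ++ repr y).

Definition tensor_opp (x : tensor) : tensor :=
  tensor_sum [seq (- u.1, u.2) | u <- repr x].

Lemma tensor_addE s t :
  tensor_add (tensor_sum s) (tensor_sum t) = tensor_sum (s ++ t).
Proof.
apply/tensor_sumP/tensor_rel_cat; apply/tensor_sumP; exact: tensor_sum_reprK.
Qed.

Lemma tensor_addA : associative tensor_add.
Proof.
move=> x y z.
rewrite -[x]tensor_sum_reprK -[y]tensor_sum_reprK -[z]tensor_sum_reprK.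
by rewrite !tensor_addE catA.
Qed.

Lemma tensor_addC : commutative tensor_add.
Proof.
move=> x y; rewrite -[x]tensor_sum_reprK -[y]tensor_sum_reprK !tensor_addE.
exact/tensor_sumP/tensor_rel_catC.
Qed.

Lemma tensor_add0 : left_id (tensor_sum [::]) tensor_add.
Proof. by move=> x; rewrite -[x]tensor_sum_reprK tensor_addE. Qed.

Lemma tensor_addN : left_inverse (tensor_sum [::]) tensor_opp tensor_add.
Proof.
move=> x; rewrite -{2}[x]tensor_sum_reprK /tensor_opp tensor_addE.
elim: (repr x) => [//|[m n] s IHs] /=.
set s' := [seq _ | _ <- s] in IHs *.
have -> : tensor_sum ((- m, n) :: s' ++ (m, n) :: s) =
    tensor_add (tensor_sum [:: (- m, n); (m, n)]) (tensor_sum (s' ++ s)).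
  rewrite (tensor_addE [:: (- m, n); (m, n)]) -cat1s -[(m, n) :: s]cat1s.
  rewrite -[LHS]tensor_addE -tensor_addE -(tensor_addE [:: (m, n)] s).
  rewrite (tensor_addA (tensor_sum s')) (tensor_addC (tensor_sum s')).
  by rewrite !tensor_addE.
have -> : tensor_sum [:: (- m, n); (m, n)] = tensor_sum [::].
  apply/tensor_sumP/(tensor_rel_trans _ (tensor_rel0 n)).
  by rewrite -(addNr m); apply/tensor_rel_sym/tensor_relDl.
by rewrite tensor_add0.
Qed.

HB.instance Definition _ := GRing.isZmodule.Build tensor
  tensor_addA tensor_addC tensor_add0 tensor_addN.

Definition pure (m : M) (n : N) : tensor := tensor_sum [:: (m, n)].

Lemma tensor_sumE s : tensor_sum s = \sum_(u <- s) pure u.1 u.2.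
Proof.
elim: s => [|[m n] s IHs]; first by rewrite big_nil.
by rewrite big_cons /= -IHs [RHS]tensor_addE.
Qed.

Lemma pureDl m m' n : pure (m + m') n = pure m n + pure m' n.
Proof. by rewrite [RHS]tensor_addE; apply/tensor_sumP/tensor_relDl. Qed.

Lemma pureDr m n n' : pure m (n + n') = pure m n + pure m n'.
Proof. by rewrite [RHS]tensor_addE; apply/tensor_sumP/tensor_relDr. Qed.

Lemma pureZ a m n : pure (a *: m) n = pure m (a *: n).
Proof. exact/tensor_sumP/tensor_relZ. Qed.

Lemma tensor_ind (P : tensor -> Prop) : P 0 ->
  (forall x y, P x -> P y -> P (x + y)) -> (forall m n, P (pure m n)) ->
  forall x, P x.
Proof.
move=> P0 PD Pp x; rewrite -[x]tensor_sum_reprK tensor_sumE.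
by elim/big_ind: _.
Qed.

(* The additive map out of the tensor product determined by a balanced
   biadditive map [b]; it has this meaning only when [balanced b]. *)
Definition balanced (P : zmodType) (b : M -> N -> P) : Prop :=
  [/\ forall m m' n, b (m + m') n = b m n + b m' n,
      forall m n n', b m (n + n') = b m n + b m n' &
      forall a m n, b (a *: m) n = b m (a *: n)].

Definition tensor_lift (P : zmodType) (b : M -> N -> P) (x : tensor) : P :=
  \sum_(u <- repr x) b u.1 u.2.

Section Lift.
Variables (P : zmodType) (b : M -> N -> P) (bP : balanced b).

Lemma tensor_lift_sum s :
  tensor_lift b (tensor_sum s) = \sum_(u <- s) b u.1 u.2.
Proof.
case: bP => bDl bDr bZ.
have: tensor_rel (repr (tensor_sum s)) s.
  by apply/tensor_sumP; exact: tensor_sum_reprK.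
rewrite /tensor_lift; move: (repr _) => t; elim=> {s t} //=.
- by move=> s t r _ -> _ ->.
- by move=> s s' t t' _ IHs _ IHt; rewrite !big_cat IHs IHt.
- by move=> s t; rewrite !big_cat /= addrC.
- move=> n; rewrite big_seq1 big_nil /=.
  by apply: (addrI (b 0 n)); rewrite -bDl !addr0.
- by move=> m m' n; rewrite !big_cons !big_nil !addr0 bDl.
- by move=> m n n'; rewrite !big_cons !big_nil !addr0 bDr.
- by move=> a m n; rewrite !big_seq1 bZ.
Qed.

Lemma tensor_lift_pure m n : tensor_lift b (pure m n) = b m n.
Proof. by rewrite tensor_lift_sum big_seq1. Qed.

Lemma tensor_liftD : {morph tensor_lift b : x y / x + y}.
Proof.
move=> x y; rewrite -[x]tensor_sum_reprK -[y]tensor_sum_reprK.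
by rewrite [_ + _ in LHS]tensor_addE !tensor_lift_sum big_cat.
Qed.

Lemma tensor_lift0 : tensor_lift b 0 = 0.
Proof. by rewrite [LHS](tensor_lift_sum [::]) big_nil. Qed.

Lemma tensor_lift_zmod_morphism : zmod_morphism (tensor_lift b).
Proof.
move=> x y; apply/eqP; rewrite eq_sym subr_eq -tensor_liftD; apply/eqP.
by rewrite subrK.
Qed.

End Lift.

Definition tensor_scale (a : A) : tensor -> tensor :=
  tensor_lift (fun m n => pure (a *: m) n).

Lemma tensor_scale_balanced a : balanced (fun m n => pure (a *: m) n).
Proof.
split=> [m m' n|m n n'|c m n]; rewrite ?scalerDr ?pureDl ?pureDr //.
by rewrite -pureZ !scalerA mulrC.
Qed.

Lemma tensor_scale_pure a m n : tensor_scale a (pure m n) = pure (a *: m) n.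
Proof. exact: (tensor_lift_pure (tensor_scale_balanced a)). Qed.

Lemma tensor_scaleDr : right_distributive tensor_scale +%R.
Proof. by move=> a x y; exact: (tensor_liftD (tensor_scale_balanced a)). Qed.

Lemma tensor_scale0 a : tensor_scale a 0 = 0.
Proof. exact: (tensor_lift0 (tensor_scale_balanced a)). Qed.

Lemma tensor_scaleA a b x :
  tensor_scale a (tensor_scale b x) = tensor_scale (a * b) x.
Proof.
elim/tensor_ind: x => [|x y IHx IHy|m n]; first by rewrite !tensor_scale0.
  by rewrite !tensor_scaleDr IHx IHy.
by rewrite !tensor_scale_pure scalerA.
Qed.

Lemma tensor_scale1 : left_id 1 tensor_scale.
Proof.
move=> x; elim/tensor_ind: x => [|x y IHx IHy|m n]; first by rewrite tensor_scale0.
  by rewrite tensor_scaleDr IHx IHy.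
by rewrite tensor_scale_pure scale1r.
Qed.

Lemma tensor_scaleDl x : {morph tensor_scale^~ x : a b / a + b}.
Proof.
move=> a b; elim/tensor_ind: x => [|x y IHx IHy|m n] /=.
- by rewrite !tensor_scale0 addr0.
- by rewrite !tensor_scaleDr IHx IHy addrACA.
- by rewrite !tensor_scale_pure scalerDl pureDl.
Qed.

HB.instance Definition _ := GRing.Zmodule_isLmodule.Build A tensor
  tensor_scaleA tensor_scale1 tensor_scaleDr tensor_scaleDl.

Lemma scale_pure a m n : a *: pure m n = pure (a *: m) n.
Proof. exact: tensor_scale_pure. Qed.

End Tensor.

Section TensorMap.
Variables (A : comPzRingType) (M M' N N' : lmodType A).
Variables (f : {linear M -> M'}) (g : {linear N -> N'}).

Definition tensor_map : tensor M N -> tensor M' N' :=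
  tensor_lift (fun m n => pure (f m) (g n)).

Lemma tensor_map_balanced : balanced (fun m n => pure (f m) (g n)).
Proof.
split=> [m m' n|m n n'|a m n]; rewrite ?raddfD ?pureDl ?pureDr //.
by rewrite !linearZ pureZ.
Qed.

Lemma tensor_map_pure m n : tensor_map (pure m n) = pure (f m) (g n).
Proof. exact: (tensor_lift_pure tensor_map_balanced). Qed.

Lemma tensor_map_linear : linear tensor_map.
Proof.
have mapD : {morph tensor_map : x y / x + y}.
  exact: (tensor_liftD tensor_map_balanced).
have map0 : tensor_map 0 = 0 by exact: (tensor_lift0 tensor_map_balanced).
move=> a x y; rewrite mapD; congr (_ + _).
elim/tensor_ind: x => [|x x' IHx IHx'|m n].
- by rewrite scaler0 map0 scaler0.
- by rewrite scalerDr !mapD IHx IHx' scalerDr.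
- by rewrite scale_pure !tensor_map_pure scale_pure linearZ.
Qed.

HB.instance Definition _ := GRing.isLinear.Build A (tensor M N) (tensor M' N')
  _ tensor_map tensor_map_linear.

End TensorMap.

Definition flat_module (A : comPzRingType) (M : lmodType A) : Prop :=
  forall (N N' : lmodType A) (u : {linear N -> N'}), injective u ->
    injective (tensor_map (idfun : {linear M -> M}) u).

(* B viewed as an A-module through f : A -> B. *)
Definition restrict_scalars (A B : comPzRingType) (f : {rmorphism A -> B}) : Type := B.

Section Restrict.
Variables (A B : comPzRingType) (f : {rmorphism A -> B}).

HB.instance Definition _ := GRing.ComPzRing.on (restrict_scalars f).

Definition restrict_scale (a : A) (x : restrict_scalars f) : restrict_scalars f := f a * x.

Lemma restrict_scaleA a b x :
  restrict_scale a (restrict_scale b x) = restrict_scale (a * b) x.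
Proof. by rewrite /restrict_scale rmorphM mulrA. Qed.

Lemma restrict_scale1 : left_id 1 restrict_scale.
Proof. by move=> x; rewrite /restrict_scale rmorph1 mul1r. Qed.

Lemma restrict_scaleDr : right_distributive restrict_scale +%R.
Proof. by move=> a x y; rewrite /restrict_scale mulrDr. Qed.

Lemma restrict_scaleDl x : {morph restrict_scale^~ x : a b / a + b}.
Proof. by move=> a b; rewrite /restrict_scale rmorphD mulrDl. Qed.

HB.instance Definition _ := GRing.Zmodule_isLmodule.Build A (restrict_scalars f)
  restrict_scaleA restrict_scale1 restrict_scaleDr restrict_scaleDl.

Lemma restrict_scaleE a (x : restrict_scalars f) : a *: x = (f a : restrict_scalars f) * x.
Proof. by []. Qed.

End Restrict.

Definition flat (A B : comPzRingType) (f : {rmorphism A -> B}) : Prop :=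
  flat_module (restrict_scalars f).

Definition ring_tensor (A B C : comPzRingType) (f : {rmorphism A -> B})
  (g : {rmorphism A -> C}) : Type := tensor (restrict_scalars f) (restrict_scalars g).

Section RingTensor.
Variables (A B C : comPzRingType).
Variables (f : {rmorphism A -> B}) (g : {rmorphism A -> C}).

Local Notation T := (ring_tensor f g).

HB.instance Definition _ := GRing.Lmodule.on T.

Local Notation "b (x) c" := (pure (b : restrict_scalars f) (c : restrict_scalars g) : T)
  (at level 40).

Definition ring_tensor_mul (x y : T) : T :=
  tensor_lift (fun (b : restrict_scalars f) (c : restrict_scalars g) =>
    tensor_lift (fun (b' : restrict_scalars f) (c' : restrict_scalars g) =>
      (b * b') (x) (c * c')) y) x.

Lemma ring_tensor_mull_balanced (b : restrict_scalars f) (c : restrict_scalars g) :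
  balanced (fun (b' : restrict_scalars f) (c' : restrict_scalars g) => (b * b') (x) (c * c')).
Proof.
split=> [m m' n|m n n'|a m n]; rewrite ?mulrDr ?pureDl ?pureDr //.
rewrite !restrict_scaleE (mulrCA b) (mulrCA c).
by rewrite -(restrict_scaleE (f := f)) -(restrict_scaleE (f := g)) pureZ.
Qed.

Lemma ring_tensor_mulr_balanced (y : T) :
  balanced (fun (b : restrict_scalars f) (c : restrict_scalars g) =>
    tensor_lift (fun (b' : restrict_scalars f) (c' : restrict_scalars g) =>
      (b * b') (x) (c * c')) y).
Proof.
have H := ring_tensor_mull_balanced.
elim/tensor_ind: y => [|x y [xDl xDr xZ] [yDl yDr yZ]|b' c'].
- by split=> *; rewrite !(tensor_lift0 (H _ _)) ?addr0.
- split=> *; rewrite !(tensor_liftD (H _ _)).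
  + by rewrite xDl yDl addrACA.
  + by rewrite xDr yDr addrACA.
  + by rewrite xZ yZ.
- split=> *; rewrite !(tensor_lift_pure (H _ _)) ?mulrDl ?pureDl ?pureDr //.
  by rewrite !restrict_scaleE -!mulrA -!restrict_scaleE pureZ.
Qed.

Lemma ring_tensor_mul_pure (b b' : B) (c c' : C) :
  ring_tensor_mul (b (x) c) (b' (x) c') = (b * b') (x) (c * c').
Proof.
rewrite [LHS](tensor_lift_pure (ring_tensor_mulr_balanced _)).
by rewrite (tensor_lift_pure (ring_tensor_mull_balanced _ _)).
Qed.

Lemma ring_tensor_mulDl : left_distributive ring_tensor_mul +%R.
Proof. by move=> x y z; exact: (tensor_liftD (ring_tensor_mulr_balanced _)). Qed.

Lemma ring_tensor_mul0l : left_zero 0 ring_tensor_mul.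
Proof. by move=> x; exact: (tensor_lift0 (ring_tensor_mulr_balanced _)). Qed.

Lemma ring_tensor_mulDr : right_distributive ring_tensor_mul +%R.
Proof.
move=> x y z; rewrite /ring_tensor_mul /tensor_lift -big_split /=.
apply: eq_bigr => u _.
exact: (tensor_liftD (ring_tensor_mull_balanced _ _)).
Qed.

Lemma ring_tensor_mul0r : right_zero 0 ring_tensor_mul.
Proof.
move=> x; rewrite /ring_tensor_mul {1}/tensor_lift big1 // => u _.
exact: (tensor_lift0 (ring_tensor_mull_balanced _ _)).
Qed.

Lemma ring_tensor_mulC : commutative ring_tensor_mul.
Proof.
move=> x y; elim/tensor_ind: x => [|x x' IHx IHx'|b c].
- by rewrite ring_tensor_mul0l ring_tensor_mul0r.
- by rewrite ring_tensor_mulDl ring_tensor_mulDr IHx IHx'.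
elim/tensor_ind: y => [|y y' IHy IHy'|b' c'].
- by rewrite ring_tensor_mul0l ring_tensor_mul0r.
- by rewrite ring_tensor_mulDl ring_tensor_mulDr IHy IHy'.
- by rewrite !ring_tensor_mul_pure mulrC (mulrC c).
Qed.

Lemma ring_tensor_mulA : associative ring_tensor_mul.
Proof.
move=> x y z; elim/tensor_ind: x => [|x x' IHx IHx'|b c].
- by rewrite !ring_tensor_mul0l.
- by rewrite !ring_tensor_mulDl IHx IHx'.
elim/tensor_ind: y => [|y y' IHy IHy'|b' c'].
- by rewrite !(ring_tensor_mul0l, ring_tensor_mul0r).
- by rewrite !(ring_tensor_mulDl, ring_tensor_mulDr) IHy IHy'.
elim/tensor_ind: z => [|z z' IHz IHz'|b'' c''].
- by rewrite !ring_tensor_mul0r.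
- by rewrite !ring_tensor_mulDr IHz IHz'.
- by rewrite !ring_tensor_mul_pure !mulrA.
Qed.

Lemma ring_tensor_mul1 : left_id (1 (x) 1) ring_tensor_mul.
Proof.
move=> x; elim/tensor_ind: x => [|x y IHx IHy|b c].
- by rewrite ring_tensor_mul0r.
- by rewrite ring_tensor_mulDr IHx IHy.
- by rewrite ring_tensor_mul_pure !mul1r.
Qed.

HB.instance Definition _ := GRing.Zmodule_isComPzRing.Build T
  ring_tensor_mulA ring_tensor_mulC ring_tensor_mul1 ring_tensor_mulDl.

Lemma mul_pure (b b' : B) (c c' : C) :
  (b (x) c) * (b' (x) c') = (b * b') (x) (c * c').
Proof. exact: ring_tensor_mul_pure. Qed.

Definition ring_tensor_inr (c : C) : T := 1 (x) c.

Lemma ring_tensor_inr_zmod_morphism : zmod_morphism ring_tensor_inr.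
Proof.
move=> x y; apply/eqP; rewrite eq_sym subr_eq; apply/eqP.
by rewrite /ring_tensor_inr -pureDr subrK.
Qed.

Lemma ring_tensor_inr_monoid_morphism : monoid_morphism ring_tensor_inr.
Proof. by split=> // x y; rewrite mul_pure mul1r. Qed.

HB.instance Definition _ := GRing.isZmodMorphism.Build C T
  ring_tensor_inr ring_tensor_inr_zmod_morphism.
HB.instance Definition _ := GRing.isMonoidMorphism.Build C T
  ring_tensor_inr ring_tensor_inr_monoid_morphism.

End RingTensor.

Section MultiplicationMap.
Variables (A B : comPzRingType) (f : {rmorphism A -> B}).

Definition mul_map : ring_tensor f f -> B :=
  tensor_lift (fun b b' : restrict_scalars f => b * b' : B).

Lemma mul_map_balanced : balanced (fun b b' : restrict_scalars f => b * b' : B).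
Proof.
split=> [m m' n|m n n'|a m n]; rewrite ?mulrDl ?mulrDr //.
by rewrite !restrict_scaleE mulrCA mulrA.
Qed.

Lemma mul_map_pure (b b' : restrict_scalars f) : mul_map (pure b b') = b * b'.
Proof. exact: (tensor_lift_pure mul_map_balanced). Qed.

Lemma mul_map_zmod_morphism : zmod_morphism mul_map.
Proof. exact: (tensor_lift_zmod_morphism mul_map_balanced). Qed.

HB.instance Definition _ := GRing.isZmodMorphism.Build (ring_tensor f f) B
  mul_map mul_map_zmod_morphism.

Lemma mul_map_monoid_morphism : monoid_morphism mul_map.
Proof.
split=> [|x y]; first by rewrite [LHS]mul_map_pure mulr1.
elim/tensor_ind: x => [|x x' IHx IHx'|b c].
- by rewrite mul0r !raddf0 mul0r.
- by rewrite mulrDl !raddfD /= IHx IHx' mulrDl.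
elim/tensor_ind: y => [|y y' IHy IHy'|b' c'].
- by rewrite mulr0 !raddf0 mulr0.
- by rewrite mulrDr !raddfD /= IHy IHy' mulrDr.
- by rewrite mul_pure !mul_map_pure mulrACA.
Qed.

HB.instance Definition _ := GRing.isMonoidMorphism.Build (ring_tensor f f) B
  mul_map mul_map_monoid_morphism.

End MultiplicationMap.

Definition weakly_etale (A B : comPzRingType) (f : {rmorphism A -> B}) : Prop :=
  flat f /\ flat (@mul_map A B f).

(* B' is an A-algebra through u \o f. *)
Section BaseChange.
Variables (A B B' C : comPzRingType).
Variables (f : {rmorphism A -> B}) (g : {rmorphism A -> C}).
Variable u : {rmorphism B -> B'}.

Local Notation uf := (u \o f : {rmorphism A -> B'}).

Definition restrict_map : restrict_scalars f -> restrict_scalars uf := u.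

Lemma restrict_map_linear : linear restrict_map.
Proof. by move=> a x y; rewrite /restrict_map rmorphD rmorphM. Qed.

HB.instance Definition _ := GRing.isLinear.Build A (restrict_scalars f) (restrict_scalars uf)
  _ restrict_map restrict_map_linear.

Definition ring_tensor_map : ring_tensor f g -> ring_tensor uf g :=
  tensor_map restrict_map (idfun : {linear restrict_scalars g -> restrict_scalars g}).

Lemma ring_tensor_map_zmod_morphism : zmod_morphism ring_tensor_map.
Proof. exact: raddfB. Qed.

HB.instance Definition _ := GRing.isZmodMorphism.Build (ring_tensor f g)
  (ring_tensor uf g) ring_tensor_map ring_tensor_map_zmod_morphism.

Lemma ring_tensor_map_pure (b : restrict_scalars f) (c : restrict_scalars g) :
  ring_tensor_map (pure b c) = pure (restrict_map b) c.
Proof. exact: tensor_map_pure. Qed.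

Lemma ring_tensor_map_monoid_morphism : monoid_morphism ring_tensor_map.
Proof.
split=> [|x y].
  by rewrite [LHS]ring_tensor_map_pure /restrict_map rmorph1.
elim/tensor_ind: x => [|x x' IHx IHx'|b c].
- by rewrite mul0r !raddf0 mul0r.
- by rewrite mulrDl !raddfD /= IHx IHx' mulrDl.
elim/tensor_ind: y => [|y y' IHy IHy'|b' c'].
- by rewrite mulr0 !raddf0 mulr0.
- by rewrite mulrDr !raddfD /= IHy IHy' mulrDr.
- by rewrite mul_pure !ring_tensor_map_pure mul_pure /restrict_map rmorphM.
Qed.

HB.instance Definition _ := GRing.isMonoidMorphism.Build (ring_tensor f g)
  (ring_tensor uf g) ring_tensor_map ring_tensor_map_monoid_morphism.

End BaseChange.

Record tower := Tower {
  tower_ring :> nat -> comPzRingType;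
  tower_map : forall i, {rmorphism tower_ring i -> tower_ring i.+1} }.

Definition tower_shift (T : tower) : tower :=
  Tower (fun i => tower_map T i.+1).

(* R -> T_i, the composite of e : R -> T_0 with the transition maps. *)
Fixpoint tower_struct (R : comPzRingType) (T : tower)
    (e : {rmorphism R -> T 0}) (i : nat) : {rmorphism R -> T i} :=
  if i is j.+1 then tower_map T j \o tower_struct e j else e.

Definition tower_from1 (T : tower) (i : nat) : {rmorphism T 1 -> T i.+1} :=
  @tower_struct (T 1) (tower_shift T) idfun i.

Definition torsion (A : comPzRingType) (I : ideal A) (M : lmodType A) : set M :=
  [set x | forall a, ideal_set I a -> exists2 n, (0 < n)%N & a ^+ n *: x = 0].
Arguments torsion {A} I M _.

Section Preperfectoid.
Variables (p : nat) (R : comPzRingType) (I0 : ideal R).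
Variables (T : tower) (e : {rmorphism R -> T 0}).

Definition layer (i : nat) : comPzRingType := modulo (tower_struct e i) I0.

Definition layer_proj (i : nat) : {rmorphism T i -> layer i} :=
  modulo_proj (tower_struct e i) I0.

Definition layer_map (i : nat) : {rmorphism layer i -> layer i.+1} :=
  @modulo_map _ _ _ (tower_struct e i) I0 (tower_map T i).

Definition layer_torsion (i : nat) : set (T i) :=
  torsion I0 (restrict_scalars (tower_struct e i)).
Arguments layer_torsion i _ : clear implicits.

(* The identification of R with the 0-th layer is part of the data, as an
   isomorphism e : R -> T_0: the 0-th layer of a base change is R_0 (x)_R S,
   which is S only up to canonical isomorphism.  The Frobenius projections F
   are unique by [preperfectoid_inj]. *)
Record preperfectoid : Prop := Preperfectoid {
  preperfectoid_base : bijective e /\ ideal_set I0 p%:R;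
  preperfectoid_inj : forall i, injective (layer_map i);
  preperfectoid_frob : forall i,
    range (fun x : layer i.+1 => x ^+ p) `<=` range (layer_map i);
  preperfectoid_proj : exists F : forall i, {rmorphism layer i.+1 -> layer i},
    [/\ forall i (x : layer i.+1), layer_map i (F i x) = x ^+ p,
        forall i (y : layer i), exists x, F i x = y,
        principal I0 /\
        exists I1 : ideal (T 1),
          [/\ principal I1,
              ideal_exp I1 p = ideal_ext (tower_struct e 1) I0 :> set (T 1) &
              forall i, F i @^-1` [set 0] =
                ideal_ext (layer_proj i.+1 \o tower_from1 T i) I1
                  :> set (layer i.+1)] &
        forall i,
          (forall a x, ideal_set I0 a -> layer_torsion i x ->
             tower_struct e i a * x = 0) /\
          exists Ftor : T i.+1 -> T i,
            set_bij (layer_torsion i.+1) (layer_torsion i) Ftor /\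
            forall x, layer_torsion i.+1 x ->
              F i (layer_proj i.+1 x) = layer_proj i (Ftor x)] }.

End Preperfectoid.

Section TowerTensor.
Variables (R S : comPzRingType) (T : tower) (e : {rmorphism R -> T 0}).
Variable f : {rmorphism R -> S}.

Definition tower_tensor : tower :=
  @Tower (fun i => ring_tensor (tower_struct e i) f)
    (fun i => @ring_tensor_map _ _ _ _ (tower_struct e i) f (tower_map T i)).

Definition tower_tensor_base : {rmorphism S -> tower_tensor 0} :=
  @ring_tensor_inr _ _ _ (tower_struct e 0) f.

End TowerTensor.

(* Main.v *)
(**
Over a ring of characteristic p, the relative Frobenius of a weakly etale
homomorphism is an isomorphism; so for every R-algebra D with p = 0 in D the map
d (x) s |-> d (x) s^p from (phi_* D) (x)_R S to D (x)_R S is bijective.  The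
i-th Frobenius projection of the base change is F_i (x) phi_S, the composite of
the R-linear map F_i (x) S : D_{i+1} (x) S -> (phi_* D_i) (x) S, D_i = R_i / I_0 R_i,
with that bijection, and flatness of S transfers image, kernel and torsion of
F_i to it.

For the bijectivity, flatness of the multiplication S (x)_R S -> S makes every
finite subset of its kernel annihilated by some e = sum b_j (x) c_j with
sum b_j c_j = 1.  Applied to the elements s (x) 1 - 1 (x) s, this expresses both
injectivity and surjectivity as the vanishing of an element n of a module N
over P = (phi_* D) (x)_R S with sum b_j n (x) c_j^p = 0 in N (x)_R S.  Since S
is flat, this relation already holds in (P n) (x)_R S, where the well defined map
z n (x) s |-> z^p s n turns it into n = sum b_j^p c_j^p n = 0.
*)
From HB Require Import structures.
Require Import Defs.
From mathcomp Require Import all_boot all_order all_algebra.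
From mathcomp Require Import boolp classical_sets functions.

Set Implicit Arguments.
Unset Strict Implicit.
Unset Printing Implicit Defensive.

Import GRing.Theory.
Local Open Scope ring_scope.
Local Open Scope classical_set_scope.
Local Open Scope quotient_scope.

(** * Submodules and quotient groups cut out by sets *)

Section SubmoduleOfSet.
Variables (A : comPzRingType) (N : lmodType A) (U : set N).
Hypothesis Umod : submod_closed [pred x | `[< U x >]].

(** The closure proof is an argument so that the submodule instance can be keyed on this predicate
    for every closed [U]. *)
Definition set_pred of submod_closed [pred x | `[< U x >]] : {pred N} :=
  [pred x | `[< U x >]].

HB.instance Definition _ := GRing.isSubmodClosed.Build A N (set_pred Umod) Umod.

Definition set_submod := {x : N | x \in set_pred Umod}.

HB.instance Definition _ := [isSub of set_submod for @sval _ _].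
HB.instance Definition _ := [Choice of set_submod by <:].
HB.instance Definition _ := [SubChoice_isSubLmodule of set_submod by <:].

End SubmoduleOfSet.

Section QuotientGroup.
Variables (Q : zmodType) (K : set Q).
Hypothesis Kzmod : zmod_closed [pred x | `[< K x >]].

Definition group_pred of zmod_closed [pred x | `[< K x >]] : {pred Q} :=
  [pred x | `[< K x >]].

HB.instance Definition _ := GRing.isZmodClosed.Build Q (group_pred Kzmod) Kzmod.

Definition quot_group : zmodType := Quotient.quot (group_pred Kzmod).

Definition quot_group_proj (x : Q) : quot_group := \pi x.

Lemma quot_group_projP x y : quot_group_proj x = quot_group_proj y <-> K (x - y).
Proof.
rewrite /quot_group_proj; split => [/eqP|Kxy].
  by rewrite -[_ == _]Quotient.idealrBE => /asboolP.
by apply/eqP; rewrite -[_ == _]Quotient.idealrBE; apply/asboolP.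
Qed.

Lemma quot_group_projB : zmod_morphism quot_group_proj.
Proof. by move=> x y; rewrite /quot_group_proj -[LHS]/(\pi_(quot_group) _) !raddfB. Qed.

HB.instance Definition _ :=
  GRing.isZmodMorphism.Build Q quot_group quot_group_proj quot_group_projB.

End QuotientGroup.

Section TensorSwap.
Variables (A : comPzRingType) (M N : lmodType A).

Lemma tensor_swap_balanced : balanced (fun (m : M) (n : N) => pure n m).
Proof. by split=> *; rewrite ?pureDl ?pureDr -?pureZ. Qed.

(** [flat_module] puts the flat module on the left, while base changes carry S on the right; the
    swap transports vanishing sums between the two. *)
Definition tensor_swap : tensor M N -> tensor N M :=
  tensor_lift (fun m n => pure n m).

Lemma tensor_swap_sum I (r : seq I) (m : I -> M) (n : I -> N) :
  tensor_swap (\sum_(i <- r) pure (m i) (n i)) = \sum_(i <- r) pure (n i) (m i).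
Proof.
rewrite /tensor_swap (big_morph _ (tensor_liftD tensor_swap_balanced)
  (tensor_lift0 tensor_swap_balanced)).
by apply: eq_bigr => i _; rewrite (tensor_lift_pure tensor_swap_balanced).
Qed.

End TensorSwap.

(** * Maps defined on a submodule tensored with a flat algebra *)

Section FlatLift.
Variables (R S : comPzRingType) (f : {rmorphism R -> S}).
Variables (N : lmodType R) (Q : zmodType) (K : set Q) (G : N -> (S -> Q) -> Prop).
Hypothesis fflat : flat f.
Hypothesis K0 : K 0.
Hypothesis KB : forall x y, K x -> K y -> K (x - y).
Hypothesis G0 : G 0 (fun=> 0).
Hypothesis GD : forall v v' b b', G v b -> G v' b' ->
  G (v + v') (fun s => b s + b' s).
Hypothesis GZ : forall r v b, G v b -> G (r *: v) (fun s => b (f r * s)).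
Hypothesis Gadd : forall v b, G v b -> zmod_morphism b.
Hypothesis GK : forall b s, G 0 b -> K (b s).

(* The relation [G] is a bilinear map from U x S to Q / K, where U is the
   submodule of those v that are related to something. *)
Lemma flat_lift (I : eqType) (r : seq I) (v : I -> N) (b : I -> S -> Q) (s : I -> S) :
  (forall i, i \in r -> G (v i) (b i)) ->
  \sum_(i <- r) pure (v i) (s i : restrict_scalars f) = 0 ->
  K (\sum_(i <- r) b i (s i)).
Proof.
(* Indices outside [r] receive the pair [0], [fun=> 0], which is related by [G0]. *)
wlog Gi : v b / forall i, G (v i) (b i) => [IH Gi eq0|_ eq0].
  pose v' i := if i \in r then v i else 0.
  pose b' i := if i \in r then b i else fun=> 0.
  rewrite (eq_big_seq (fun i => b' i (s i))) => [|i ir]; last by rewrite /b' ir.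
  apply: (IH v') => [i|i _|]; rewrite /v' /b'; try by case: ifP => // /Gi.
  by rewrite -[RHS]eq0; apply: eq_big_seq => i ->.
have GN v' b' : G v' b' -> G (- v') (fun s => - b' s).
  move=> Gv; rewrite -scaleN1r.
  have -> : (fun s => - b' s) = (fun s => b' (f (-1) * s)).
    apply: funext => x; have badd := Gadd Gv.
    have b0 : b' 0 = 0 by rewrite -[0 in LHS](subrr 0) badd subrr.
    by rewrite rmorphN1 mulN1r -[- x]sub0r badd b0 sub0r.
  exact: GZ.
(* Two functions related to one vector differ by a function related to 0, so [GK] makes them agree
   modulo [K]. *)
have Guniq v' b1 b2 t : G v' b1 -> G v' b2 -> K (b1 t - b2 t).
  by move=> G1 G2; have := GD G1 (GN _ _ G2); rewrite subrr => G12; exact: (GK t G12).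
pose U := [set v' | exists b', G v' b'].
have Umod : submod_closed [pred x | `[< U x >]].
  split=> [|a x y]; first by apply/asboolP; exists (fun=> 0).
  move=> /asboolP[b1 G1] /asboolP[b2 G2]; apply/asboolP.
  exists (fun s => b1 (f a * s) + b2 s); apply: GD => //; exact: GZ.
have Kz : zmod_closed [pred x | `[< K x >]].
  by split=> [|x y /asboolP Kx /asboolP Ky]; apply/asboolP => //; apply: KB.
pose V := set_submod Umod.
(* The choice [c] need not be linear in [u]; by [Guniq] it becomes so once its values are read
   modulo [K]. *)
have /choice [c cP] : forall u : V, exists b', G (\val u) b'.
  by move=> u; have /asboolP := valP u.
pose iota : {linear V -> N} := \val.
have Ui i : v i \in set_pred Umod by apply/asboolP; exists (b i).
pose vV i : V := Sub (v i) (Ui i).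
pose y : tensor (restrict_scalars f) V :=
  \sum_(i <- r) pure (s i : restrict_scalars f) (vV i).
(* This is where flatness enters: the relation holds in the tensor product with [N], and the
   inclusion of [V] into [N] stays injective after tensoring. *)
have y0 : y = 0.
  apply: (fflat (u := iota)); first exact: val_inj.
  rewrite raddf0 /y raddf_sum /=.
  under eq_bigr => i _ do rewrite tensor_map_pure.
  have := congr1 (@tensor_swap _ _ _) eq0; rewrite tensor_swap_sum => ->.
  exact: tensor_lift0 (tensor_swap_balanced _ _).
pose bb (t : restrict_scalars f) (u : V) : quot_group Kz := quot_group_proj Kz (c u t).
have bbP : balanced bb.
  split=> [t t' u|t u u'|a t u].
  - have badd := Gadd (cP u).
    rewrite /bb -raddfD; congr quot_group_proj.
    have b0 : c u 0 = 0 by rewrite -[0 in LHS](subrr 0) badd subrr.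
    have bN x : c u (- x) = - c u x by rewrite -[- x]sub0r badd b0 sub0r.
    by rewrite -[t' in LHS]opprK badd bN opprK.
  - rewrite /bb -raddfD; apply/quot_group_projP.
    have := Guniq _ _ _ t (cP (u + u')) (GD (cP u) (cP u')); exact.
  - rewrite /bb; apply/quot_group_projP.
    have H := Guniq _ _ _ t (cP (a *: u)) (GZ a (cP u)).
    by rewrite -opprB -sub0r; apply: KB.
have : tensor_lift bb y = 0 by rewrite y0 (tensor_lift0 bbP).
rewrite /y (big_morph _ (tensor_liftD bbP) (tensor_lift0 bbP)).
under eq_bigr => i _ do rewrite (tensor_lift_pure bbP) /bb.
rewrite -raddf_sum -(raddf0 (quot_group_proj Kz)) => /quot_group_projP.
rewrite subr0 => Kc.
(* Replacing the chosen functions by the given ones changes each term by an element of [K]. *)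
have : K (\sum_(i <- r) (c (vV i) (s i) - b i (s i))).
  elim/big_rec: _ => // i x _ Kx.
  rewrite -[x]opprK; apply: KB; first exact: (Guniq (v i) _ _ _ (cP (vV i))).
  by rewrite -sub0r; apply: KB.
rewrite sumrB => Kd; rewrite -[X in K X](subKr (\sum_(i <- r) c (vV i) (s i))).
exact: KB.
Qed.

End FlatLift.

(** * Ring tensor products and flatness *)

Lemma pure0l (A : comPzRingType) (M N : lmodType A) (n : N) : pure (0 : M) n = 0.
Proof. exact/tensor_sumP/tensor_rel0. Qed.

Lemma pure0r (A : comPzRingType) (M N : lmodType A) (m : M) : pure m (0 : N) = 0.
Proof. by rewrite -(scale0r (0 : N)) -pureZ scale0r pure0l. Qed.

Lemma pure_sumP (A : comPzRingType) (M N : lmodType A) (x : tensor M N) :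
  exists s : seq (M * N), x = \sum_(u <- s) pure u.1 u.2.
Proof. by exists (repr x); rewrite -[x in LHS]tensor_sum_reprK tensor_sumE. Qed.

Section RingTensorUniversal.
Variables (A B C E : comPzRingType).
Variables (f : {rmorphism A -> B}) (g : {rmorphism A -> C}).

Definition ring_tensor_inl (b : B) : ring_tensor f g :=
  pure (b : restrict_scalars f) (1 : restrict_scalars g).

Lemma ring_tensor_inl_zmod_morphism : zmod_morphism ring_tensor_inl.
Proof.
move=> x y; apply/eqP; rewrite eq_sym subr_eq; apply/eqP.
by rewrite /ring_tensor_inl -pureDl subrK.
Qed.

Lemma ring_tensor_inl_monoid_morphism : monoid_morphism ring_tensor_inl.
Proof. by split=> // x y; rewrite mul_pure mul1r. Qed.

HB.instance Definition _ := GRing.isZmodMorphism.Build B (ring_tensor f g)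
  ring_tensor_inl ring_tensor_inl_zmod_morphism.
HB.instance Definition _ := GRing.isMonoidMorphism.Build B (ring_tensor f g)
  ring_tensor_inl ring_tensor_inl_monoid_morphism.

Lemma pureE (b : restrict_scalars f) (c : restrict_scalars g) :
  pure b c = ring_tensor_inl b * ring_tensor_inr f g c :> ring_tensor f g.
Proof. by rewrite mul_pure mulr1 mul1r. Qed.

Lemma ring_tensor_glue a :
  ring_tensor_inl (f a) = ring_tensor_inr f g (g a).
Proof.
have := pureZ a (1 : restrict_scalars f) (1 : restrict_scalars g).
by rewrite !restrict_scaleE !mulr1.
Qed.

Lemma ring_tensor_ext (h k : {rmorphism ring_tensor f g -> E}) :
  (forall b, h (ring_tensor_inl b) = k (ring_tensor_inl b)) ->
  (forall c, h (ring_tensor_inr f g c) = k (ring_tensor_inr f g c)) -> h =1 k.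
Proof.
move=> hl hr x; elim/tensor_ind: x => [|x y IHx IHy|b c]; first by rewrite !raddf0.
  by rewrite !raddfD /= IHx IHy.
by rewrite pureE !rmorphM hl hr.
Qed.

Section RingTensorLift.
Variables (h : {rmorphism B -> E}) (k : {rmorphism C -> E}).
Hypothesis hk : forall a, h (f a) = k (g a).

(** The compatibility proof is an argument so that the ring morphism instance is available for any
    compatible pair. *)
Definition ring_tensor_lift of (forall a, h (f a) = k (g a)) : ring_tensor f g -> E :=
  tensor_lift (fun (b : restrict_scalars f) (c : restrict_scalars g) => h b * k c).

Local Notation lift := (ring_tensor_lift hk).

Lemma ring_tensor_lift_balanced :
  balanced (fun (b : restrict_scalars f) (c : restrict_scalars g) => h b * k c).
Proof.
split=> [m m' n|m n n'|a m n]; rewrite ?rmorphD ?mulrDl ?mulrDr //.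
by rewrite !restrict_scaleE !rmorphM /= hk mulrCA mulrA.
Qed.

Lemma ring_tensor_lift_pure (b : restrict_scalars f) (c : restrict_scalars g) :
  lift (pure b c) = h b * k c.
Proof. exact: (tensor_lift_pure ring_tensor_lift_balanced). Qed.

Lemma ring_tensor_lift_zmod_morphism : zmod_morphism lift.
Proof. exact: (tensor_lift_zmod_morphism ring_tensor_lift_balanced). Qed.

HB.instance Definition _ := GRing.isZmodMorphism.Build (ring_tensor f g) E
  lift ring_tensor_lift_zmod_morphism.

Lemma ring_tensor_lift_monoid_morphism : monoid_morphism lift.
Proof.
split=> [|x y]; first by rewrite [LHS]ring_tensor_lift_pure !rmorph1 mulr1.
elim/tensor_ind: x => [|x x' IHx IHx'|b c].
- by rewrite mul0r !raddf0 mul0r.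
- by rewrite mulrDl !raddfD /= IHx IHx' mulrDl.
elim/tensor_ind: y => [|y y' IHy IHy'|b' c'].
- by rewrite mulr0 !raddf0 mulr0.
- by rewrite mulrDr !raddfD /= IHy IHy' mulrDr.
- by rewrite mul_pure !ring_tensor_lift_pure !rmorphM mulrACA.
Qed.

HB.instance Definition _ := GRing.isMonoidMorphism.Build (ring_tensor f g) E
  lift ring_tensor_lift_monoid_morphism.

Lemma ring_tensor_lift_inl b : lift (ring_tensor_inl b) = h b.
Proof. by rewrite [LHS]ring_tensor_lift_pure rmorph1 mulr1. Qed.

Lemma ring_tensor_lift_inr c : lift (ring_tensor_inr f g c) = k c.
Proof. by rewrite [LHS]ring_tensor_lift_pure rmorph1 mul1r. Qed.

End RingTensorLift.
End RingTensorUniversal.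

Arguments ring_tensor_inl {A B C} f g b.

(** Modulo tensors whose first component is in the kernel of [u], the assignment u n (x) s |-> n (x)
    s is well defined, and [flat_lift] lets it be applied to the relation in B' (x) S. Only
    additivity and compatibility with R are asked of [u], so that multiplication by an element is
    covered as well as ring morphisms. *)
Lemma flat_kernel (R S B B' : comPzRingType) (f : {rmorphism R -> S})
    (g : {rmorphism R -> B}) (g' : {rmorphism R -> B'}) (u : {additive B -> B'})
    (I : eqType) (r : seq I) (n : I -> B) (s : I -> S) :
  flat f -> (forall a b, u (g a * b) = g' a * u b) ->
  \sum_(i <- r) pure (u (n i) : restrict_scalars g') (s i : restrict_scalars f) = 0 ->
  exists t : seq (B * S), (forall y, y \in t -> u y.1 = 0) /\
    \sum_(i <- r) pure (n i : restrict_scalars g) (s i : restrict_scalars f) =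
    \sum_(y <- t) pure (y.1 : restrict_scalars g) (y.2 : restrict_scalars f).
Proof.
move=> fflat uZ.
pose K := [set x : ring_tensor g f | exists t : seq (B * S),
  (forall y, y \in t -> u y.1 = 0) /\
  x = \sum_(y <- t) pure (y.1 : restrict_scalars g) (y.2 : restrict_scalars f)].
have K0 : K 0 by exists [::]; rewrite big_nil.
have KN x : K x -> K (- x).
  move=> [t [ut ->]]; exists [seq (- y.1, y.2) | y <- t]; split.
    by move=> _ /mapP[y /ut uy ->]; rewrite raddfN uy oppr0.
  rewrite big_map -sumrN; apply: eq_bigr => y _ /=.
  by rewrite !pureE raddfN mulNr.
have KD x y : K x -> K y -> K (x + y).
  move=> [t [ut ->]] [t' [ut' ->]]; exists (t ++ t'); rewrite big_cat; split=> // z.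
  by rewrite mem_cat => /orP[/ut|/ut'].
pose G (v : restrict_scalars g') (b : S -> ring_tensor g f) := exists n : B, u n = v /\
  forall s, b s = pure (n : restrict_scalars g) (s : restrict_scalars f).
move=> sum0.
have := @flat_lift _ _ f _ _ K G fflat K0 _ _ _ _ _ _ I r (fun i => u (n i))
  (fun i t => pure (n i : restrict_scalars g) (t : restrict_scalars f)) s _ sum0; apply.
- by move=> x y Kx Ky; exact: (KD _ _ Kx (KN _ Ky)).
- by exists 0; split=> [|t]; [exact: raddf0|rewrite pure0l].
- move=> v v' b b' [m [mv bm]] [m' [mv' bm']]; exists (m + m').
  by split=> [|t]; [rewrite raddfD mv mv'|rewrite bm bm' pureDl].
- move=> a v b [m [mv bm]]; exists (g a * m).
  split=> [|t]; first by rewrite uZ mv.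
  by rewrite bm -!restrict_scaleE pureZ.
- by move=> v b [m [mv bm]] x y; rewrite !bm !pureE raddfB mulrBr.
- move=> b t [m [m0 bm]]; exists [:: (m, t)]; rewrite big_seq1 bm; split=> //.
  by move=> _ /[!inE] /eqP ->.
- by move=> i _; exists (n i).
Qed.

(* Flatness of the quotient (S (x) S) / J means that every x in J lies in J x. *)
Lemma weakly_etale_annihilator (R S : comPzRingType) (f : {rmorphism R -> S})
    (s : seq (ring_tensor f f)) :
  flat (@mul_map R S f) -> (forall x, x \in s -> mul_map x = 0) ->
  exists e, mul_map e = 1 /\ forall x, x \in s -> e * x = 0.
Proof.
move=> muflat; elim: s => [|x s IHs] sJ; first by exists 1; split=> //; exact: rmorph1.
have [y xs|e [e1 es]] := IHs; first by apply: sJ; rewrite inE xs orbT.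
have x0 : mul_map x = 0 by apply: sJ; rewrite inE eqxx.
(* If x = y x with y in J, then 1 - y kills x and has image 1 in S, so it may be multiplied onto the
   annihilator found for the tail. *)
suff [y [y0 xy]] : exists y, mul_map y = 0 /\ x = y * x.
  exists (e * (1 - y)); split=> [|z].
    by rewrite rmorphM raddfB /= rmorph1 y0 e1 subr0 mulr1.
  rewrite inE => /predU1P[->|zs]; last by rewrite mulrAC es // mul0r.
  by rewrite -mulrA mulrBl mul1r -xy subrr mulr0.
pose K := [set z : ring_tensor f f | exists y, mul_map y = 0 /\ z = y * x].
have K0 : K 0 by exists 0; rewrite mul0r raddf0.
have KB z z' : K z -> K z' -> K (z - z').
  move=> [y [y0 ->]] [y' [y0' ->]]; exists (y - y').
  by rewrite mulrBl raddfB /= y0 y0' subrr.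
have KD z z' : K z -> K z' -> K (z + z').
  by move=> Kz Kz'; rewrite -[z']opprK -[- z']sub0r; exact: (KB _ _ Kz (KB _ _ K0 Kz')).
(* [G] encodes the bilinear map (l x, t) |-> l (1 (x) t) x modulo J x, defined on the ideal of
   multiples of [x]. *)
pose G (v : restrict_scalars (idfun : {rmorphism ring_tensor f f -> ring_tensor f f}))
    (b : S -> ring_tensor f f) :=
  zmod_morphism b /\ exists l, v = l * x /\
    forall t, K (b t - l * ring_tensor_inr f f t * x).
suff [y [y0 xy]] : K (ring_tensor_inr f f 1 * x).
  by exists y; split=> //; rewrite -xy rmorph1 mul1r.
pose F : unit -> restrict_scalars (idfun : {rmorphism ring_tensor f f -> ring_tensor f f})
 := fun=> x.
pose b0 := fun (_ : unit) (t : S) => ring_tensor_inr f f t * x.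
have := @flat_lift _ _ _ _ _ K G muflat K0 KB _ _ _ _ _ unit [:: tt] F b0 (fun=> 1).
rewrite !big_seq1; apply.
- split; first by move=> ? ?; rewrite subrr.
  by exists 0; rewrite !mul0r; split=> // t; rewrite !mul0r subrr.
- move=> v v' b b' [ba [l [-> bl]]] [ba' [l' [-> bl']]]; split.
    by move=> t t'; rewrite ba ba' opprD addrACA.
  by exists (l + l'); split=> [|t]; rewrite ?mulrDl // opprD addrACA; exact: (KD _ _ (bl t) (bl' t)).
- move=> a v b [ba [l [-> bl]]]; split; first by move=> t t'; rewrite mulrBr ba.
  exists (a * l); split=> [|t]; first by rewrite restrict_scaleE /= mulrA.
  (* The error term is a multiple of (1 (x) mul_map a - a) x, and the bracket lies in J. *)
  have -> : b (mul_map a * t) - a * l * ring_tensor_inr f f t * x =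
     (b (mul_map a * t) - l * ring_tensor_inr f f (mul_map a * t) * x) +
     (l * ring_tensor_inr f f t * (ring_tensor_inr f f (mul_map a) - a)) * x.
    rewrite rmorphM mulrBr mulrBl (mulrC a) (mulrC (ring_tensor_inr f f (mul_map a))).
    by rewrite !mulrA addrA subrK (mulrAC l a).
  apply: (KD _ _ (bl _)); eexists; split; last by [].
  by rewrite rmorphM raddfB /= [mul_map (ring_tensor_inr _ _ _)]mul_map_pure mul1r subrr mulr0.
- by move=> v b [].
- move=> b t [ba [l [lx bl]]]; have := bl t.
  by rewrite mulrAC -lx mul0r subr0.
- move=> [] _; split; first by move=> t t'; rewrite /b0 raddfB mulrBl.
  by exists 1; rewrite mul1r; split=> // t; rewrite mul1r subrr.
(* Moving the scalar [x] across the tensor sign turns x (x) 1 into 1 (x) mul_map x, which is 0. *)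
- have -> : F tt = x *: (1 : restrict_scalars idfun) by rewrite restrict_scaleE mulr1.
  have x1 : x *: (1 : restrict_scalars (@mul_map R S f)) = 0.
    by rewrite restrict_scaleE [LHS]mulr1; exact: x0.
  by rewrite pureZ /= [X in pure _ X]x1 pure0r.
Qed.

(** * The relative Frobenius *)

(* MathComp's [pFrobenius_aut] excludes the zero ring. *)
Section Frobenius.
Variables (p : nat) (D : comPzRingType).
Hypotheses (p_prime : prime p) (pD : p%:R = 0 :> D).

Definition frobenius of prime p & p%:R = 0 :> D := fun x : D => x ^+ p.

Local Notation Fr := (frobenius p_prime pD).

Lemma frobeniusD : {morph Fr : x y / x + y}.
Proof.
move=> x y; rewrite /frobenius exprDn.
move: p p_prime pD => [|q] // q_prime qD.
rewrite big_ord_recl big_ord_recr /= subn0 subnn !expr0 mulr1 mul1r bin0.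
rewrite binn !mulr1n big1 ?add0r // => i _.
have /dvdnP[k ->] : (q.+1 %| 'C(q.+1, bump 0 i))%N.
  by apply: prime_dvd_bin; rewrite //= /bump /= add1n ltnS ltn_ord.
by rewrite -mulr_natr natrM qD !mulr0.
Qed.

Lemma frobenius_zmod_morphism : zmod_morphism Fr.
Proof.
by move=> x y; apply/eqP; rewrite eq_sym subr_eq -frobeniusD subrK.
Qed.

Lemma frobenius_monoid_morphism : monoid_morphism Fr.
Proof. by split=> [|x y]; rewrite /frobenius ?expr1n ?exprMn. Qed.

HB.instance Definition _ :=
  GRing.isZmodMorphism.Build D D Fr frobenius_zmod_morphism.
HB.instance Definition _ :=
  GRing.isMonoidMorphism.Build D D Fr frobenius_monoid_morphism.

End Frobenius.

Lemma rmorph_nat0 (p : nat) (D E : comPzRingType) (h : {rmorphism D -> E}) :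
  p%:R = 0 :> D -> p%:R = 0 :> E.
Proof. by move=> pD; rewrite -(rmorph_nat h) pD rmorph0. Qed.

Lemma expr_annihilates (p : nat) (D : comPzRingType) (x y : D) :
  prime p -> x * y = 0 -> x ^+ p * y = 0.
Proof. by case: p => // p _ xy; rewrite exprSr -mulrA xy mulr0. Qed.

Section RelativeFrobenius.
Variables (p : nat) (R S : comPzRingType) (f : {rmorphism R -> S}).
Hypotheses (p_prime : prime p) (fflat : flat f).

(* Applies the bilinear map (h z * n + w, s) |-> h (z ^+ p * sigma s) * n,
   which is well defined modulo C. *)
Lemma frobenius_descent (P E : comPzRingType) (rho : {rmorphism R -> P})
    (sigma : {rmorphism S -> P}) (h : {rmorphism P -> E}) (C : set E) (n : E)
    (J : eqType) (r : seq J) (b c : J -> S) (t : seq (E * S)) :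
  p%:R = 0 :> P -> (forall a, sigma (f a) = rho a ^+ p) ->
  C 0 -> (forall x y, C x -> C y -> C (x + y)) -> (forall z x, C x -> C (h z * x)) ->
  \sum_(j <- r) b j * c j = 1 ->
  \sum_(j <- r) pure (h (sigma (b j)) * n : restrict_scalars (h \o rho))
     (c j ^+ p : restrict_scalars f) =
  \sum_(y <- t) pure (y.1 : restrict_scalars (h \o rho)) (y.2 : restrict_scalars f) ->
  (forall y, y \in t -> C y.1) -> C n.
Proof.
move=> pP rhoE C0 CD CM bc1 eqt Ct.
have CN x : C x -> C (- x).
  by move=> Cx; rewrite -mulN1r -(rmorph1 h) -rmorphN; apply: CM.
pose Fr := frobenius p_prime pP.
pose G (v : restrict_scalars (h \o rho)) (g : S -> E) := exists z w, [/\ C w,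
  v = h z * n + w & forall s, g s = h (z ^+ p * sigma s) * n].
(* Both sides of the relation are joined into one vanishing sum over [J + E * S]; the tensors from
   [C] enter with a minus sign and are sent to 0. *)
pose v (i : J + E * S) : E :=
  match i with inl j => h (sigma (b j)) * n | inr y => - y.1 end.
pose g (i : J + E * S) : S -> E := match i with
  inl j => fun s => h (sigma (b j) ^+ p * sigma s) * n | inr _ => fun=> 0 end.
pose s (i : J + E * S) : S := match i with inl j => c j ^+ p | inr y => y.2 end.
have p_gt0 := prime_gt0 p_prime.
have := @flat_lift _ _ f (restrict_scalars (h \o rho)) _ C G fflat C0 _ _ _ _ _ _
  (J + E * S)%type (map inl r ++ map inr t) v g s.
rewrite !big_cat !big_map /= [X in C (_ + X)]big1 // addr0.
(* Frobenius is additive on P, so the sum of b_j^p c_j^p is the p-th power of the sum of b_j c_j,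
   namely 1. *)
have -> : \sum_(j <- r) h (sigma (b j) ^+ p * sigma (c j ^+ p)) * n = n.
  under eq_bigr => j _ do rewrite rmorphXn -exprMn -rmorphM.
  rewrite -mulr_suml -rmorph_sum -[X in h X](rmorph_sum Fr) -rmorph_sum bc1.
  by rewrite !rmorph1 mul1r.
apply.
- by move=> x y Cx Cy; apply: CD => //; apply: CN.
- exists 0, 0; rewrite rmorph0 mul0r addr0 expr0n gtn_eqF //; split=> // x.
  by rewrite mul0r rmorph0 mul0r.
- move=> x x' k k' [z [w [Cw -> kE]]] [z' [w' [Cw' -> kE']]].
  exists (z + z'), (w + w'); split; first exact: CD.
    by rewrite rmorphD mulrDl addrACA.
  by move=> y; rewrite kE kE' -mulrDl -rmorphD -mulrDl [(z + z') ^+ p](rmorphD Fr).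
- move=> a x k [z [w [Cw -> kE]]]; exists (rho a * z), (h (rho a) * w).
  split; first exact: CM.
    by rewrite restrict_scaleE mulrDr rmorphM !mulrA.
  by move=> y; rewrite kE exprMn [sigma (_ * _)]rmorphM rhoE mulrCA mulrA.
- by move=> x k [z [w [_ _ kE]]] y y'; rewrite !kE raddfB mulrBr raddfB mulrBl.
- move=> k y [z [w [Cw /esym/eqP zn kE]]]; rewrite kE.
  move: zn; rewrite addr_eq0 => /eqP zn.
  (* Since p > 0, one factor z can be split off z^p, and h z * n = - w already lies in [C]. *)
  case: (p) p_gt0 => // q _; rewrite exprSr mulrAC rmorphM -mulrA zn.
  by apply/CM/CN.
- move=> i; rewrite mem_cat => /orP[/mapP[j _ ->]|/mapP[y yt ->]].
    by exists (sigma (b j)), 0; rewrite addr0; split.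
  exists 0, (v (inr y)); split; first exact/CN/Ct.
    by rewrite rmorph0 mul0r add0r.
  by move=> x; rewrite expr0n gtn_eqF // mul0r rmorph0 mul0r.
- rewrite eqt -big_split big1 //= => y _.
  by rewrite -pureDl subrr pure0l.
Qed.

Hypothesis mulflat : flat (@mul_map R S f).
Variables (D : comPzRingType) (pD : p%:R = 0 :> D) (g : {rmorphism R -> D}).

(** This is the R-algebra phi_* D. *)
Definition frobenius_twist : {rmorphism R -> D} := frobenius p_prime pD \o g.

Local Notation P := (ring_tensor frobenius_twist f).
Local Notation E := (ring_tensor g f).

Let pE : p%:R = 0 :> E := rmorph_nat0 (ring_tensor_inl g f) pD.

Lemma relative_frobenius_glue a :
  ring_tensor_inl g f (frobenius_twist a) =
  (frobenius p_prime pE \o ring_tensor_inr g f) (f a).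
Proof. by rewrite /= /frobenius rmorphXn /= ring_tensor_glue. Qed.

Definition relative_frobenius : {rmorphism P -> E} :=
  ring_tensor_lift relative_frobenius_glue.

Lemma relative_frobenius_inl d :
  relative_frobenius (ring_tensor_inl _ _ d) = ring_tensor_inl _ _ d.
Proof. exact: ring_tensor_lift_inl. Qed.

Lemma relative_frobenius_inr s :
  relative_frobenius (ring_tensor_inr _ _ s) = ring_tensor_inr _ _ s ^+ p.
Proof. exact: ring_tensor_lift_inr. Qed.

Let pP : p%:R = 0 :> P := rmorph_nat0 (ring_tensor_inl frobenius_twist f) pD.

(** P has two structure maps from R: the untwisted [rho] through D, and the one through S, which is
    the p-th power of [rho]. The modules over P below are tensored with S along the untwisted
    one. *)
Let rho : {rmorphism R -> P} := ring_tensor_inl frobenius_twist f \o g.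
Let sigma : {rmorphism S -> P} := ring_tensor_inr frobenius_twist f.

Let sigma_rho a : sigma (f a) = rho a ^+ p.
Proof. by rewrite /sigma /rho /= -rmorphXn -ring_tensor_glue. Qed.

(** Write n as a sum of d (x) s. In W = P (x)_R S the image of [relative_frobenius n] under [kappa]
    is 0; subtracting it from n (x) 1 leaves a combination of the elements [H (s (x) 1 - 1 (x) s)],
    all killed by [H e]. Expanding [H e * inlW n = 0] gives the relation needed for descent with C =
    0. *)
Lemma relative_frobenius_eq0 n : relative_frobenius n = 0 -> n = 0.
Proof.
move=> n0; have [r nE] := pure_sumP n.
have [//|e [e1 ex]] := @weakly_etale_annihilator _ _ f
  [seq ring_tensor_inl f f y.2 - ring_tensor_inr f f y.2 | y <- r] mulflat.
  move=> _ /mapP[y _ ->].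
  by rewrite raddfB /= [X in X - _]mul_map_pure [X in _ - X]mul_map_pure mulr1 mul1r subrr.
have [q eE] := pure_sumP e.
pose W := ring_tensor ((idfun : {rmorphism P -> P}) \o rho) f.
pose inlW : {rmorphism P -> W} := ring_tensor_inl _ f.
pose inrW : {rmorphism S -> W} := ring_tensor_inr _ f.
have glueW a : inlW (rho a) = inrW (f a) := @ring_tensor_glue _ _ _ (idfun \o rho) f a.
have pW : p%:R = 0 :> W := rmorph_nat0 inlW pP.
have glueH a : (inlW \o sigma) (f a) = (frobenius p_prime pW \o inrW) (f a).
  by rewrite /= /frobenius sigma_rho rmorphXn glueW.
(* [H] is b (x) c |-> sigma b (x) c^p; the power on the right matches the twist carried by
   [sigma]. *)
pose H : {rmorphism ring_tensor f f -> W} := ring_tensor_lift glueH.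
have glueK a : (inlW \o ring_tensor_inl frobenius_twist f) (g a) = inrW (f a) by exact: glueW.
(* [kappa] is d (x) s |-> (d (x) 1) (x) s. *)
pose kappa : {rmorphism E -> W} := ring_tensor_lift glueK.
have Hn : H e * inlW n = 0.
  have -> : inlW n = \sum_(y <- r) inlW (ring_tensor_inl frobenius_twist f y.1) *
      H (ring_tensor_inl f f y.2 - ring_tensor_inr f f y.2).
    have kn : kappa (relative_frobenius n) = 0 by rewrite n0 rmorph0.
    rewrite -[LHS]subr0 -[X in _ - X]kn nE [inlW _]rmorph_sum.
    rewrite [relative_frobenius _]rmorph_sum [kappa _]rmorph_sum -sumrB.
    apply: eq_bigr => y _; rewrite pureE [relative_frobenius _]rmorphM.
    rewrite relative_frobenius_inl relative_frobenius_inr.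
    rewrite [inlW (_ * _)]rmorphM [kappa _]rmorphM [kappa (_ ^+ p)]rmorphXn.
    rewrite [kappa (ring_tensor_inl _ _ _)]ring_tensor_lift_inl.
    rewrite [kappa (ring_tensor_inr _ _ _)]ring_tensor_lift_inr -mulrBr.
    congr (_ * _).
    by rewrite /H raddfB /= ring_tensor_lift_inl ring_tensor_lift_inr.
  rewrite mulr_sumr big_seq big1 // => y yr.
  by rewrite mulrCA -rmorphM ex ?rmorph0 ?mulr0 //; apply: map_f.
apply: (@frobenius_descent P P rho sigma idfun [set 0] n _ q (fun y => y.1) (fun y => y.2)
  [::]) => //.
- by move=> x y -> ->; rewrite /= addr0.
- by move=> z x -> /=; rewrite mulr0.
- by rewrite -e1 eE rmorph_sum; apply: eq_bigr => y _; rewrite [RHS]mul_map_pure.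
- rewrite big_nil -[RHS]Hn eE rmorph_sum mulr_suml; apply: eq_bigr => y _.
  rewrite !pureE !rmorphM /H /= ring_tensor_lift_inl ring_tensor_lift_inr /=.
  by rewrite mulrAC /frobenius rmorphXn.
Qed.

(** Descent is applied to n = 1 (x) b modulo the image [C]: the annihilator relation lets b move to
    the right factor of W = E (x)_R S, where the remaining left factors lie in the image. *)
Lemma relative_frobenius_surj x : exists n, relative_frobenius n = x.
Proof.
pose C := range relative_frobenius.
have C0 : C 0 by exists 0 => //; exact: rmorph0.
have CD y z : C y -> C z -> C (y + z).
  by move=> [y' _ <-] [z' _ <-]; exists (y' + z') => //; exact: rmorphD.
have CM y z : C z -> C (relative_frobenius y * z).
  by move=> [z' _ <-]; exists (y * z') => //; exact: rmorphM.
(* [C] is stable under P, and d (x) b is 1 (x) b multiplied by the image of d (x) 1. *)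
suff inrC b : C (ring_tensor_inr g f b).
  suff [n _ <-] : C x by exists n.
  elim/tensor_ind: x => [|y z|d b]; [exact: C0|exact: CD|].
  by rewrite pureE -relative_frobenius_inl; apply: CM.
have [|e [e1 ex]] := @weakly_etale_annihilator _ _ f
  [:: ring_tensor_inl f f b - ring_tensor_inr f f b] mulflat.
  move=> _ /[!inE] /eqP ->.
  by rewrite raddfB /= [X in X - _]mul_map_pure [X in _ - X]mul_map_pure mulr1 mul1r subrr.
have {ex} := ex _ (mem_head _ _).
have [q eE] := pure_sumP e => eb.
pose W := ring_tensor (relative_frobenius \o rho) f.
pose inlW : {rmorphism E -> W} := ring_tensor_inl _ f.
pose inrW : {rmorphism S -> W} := ring_tensor_inr _ f.
have pW : p%:R = 0 :> W := rmorph_nat0 inlW pE.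
have glueH a : (inlW \o ring_tensor_inr g f) (f a) = inrW (f a).
  have := @ring_tensor_glue _ _ _ (relative_frobenius \o rho) f a.
  by rewrite -[in X in _ -> X]/inrW /= relative_frobenius_inl ring_tensor_glue.
pose H : {rmorphism ring_tensor f f -> W} := ring_tensor_lift glueH.
have Hl y : H (ring_tensor_inl f f y) = inlW (ring_tensor_inr g f y).
  exact: ring_tensor_lift_inl.
have Hr y : H (ring_tensor_inr f f y) = inrW y by exact: ring_tensor_lift_inr.
(* The p-th power of [H e] is taken because [relative_frobenius (sigma b)] is 1 (x) b^p, so descent
   needs p-th powers on both factors. *)
have Heb : H e ^+ p * H (ring_tensor_inl f f b) = H e ^+ p * H (ring_tensor_inr f f b).
  apply/eqP; rewrite -subr_eq0 -mulrBr -raddfB; apply/eqP/(expr_annihilates p_prime).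
  by rewrite -[LHS]rmorphM eb rmorph0.
have He : H e ^+ p = \sum_(y <- q) (inlW (ring_tensor_inr g f y.1) * inrW y.2) ^+ p.
  rewrite eE rmorph_sum -[LHS]/(frobenius p_prime pW _) rmorph_sum.
  apply: eq_bigr => y _; rewrite pureE.
  by rewrite -Hl -Hr -rmorphM.
apply: (@frobenius_descent P E rho sigma relative_frobenius C _ _ q
  (fun y => y.1) (fun y => y.2)
  [seq (relative_frobenius (sigma y.1), y.2 ^+ p * b) | y <- q]) => //.
- by rewrite -e1 eE rmorph_sum; apply: eq_bigr => y _; rewrite [RHS]mul_map_pure.
- rewrite big_map; transitivity (H e ^+ p * H (ring_tensor_inl f f b)).
    rewrite He Hl mulr_suml; apply: eq_bigr => y _.
    rewrite pureE relative_frobenius_inr exprMn -[ring_tensor_inl _ _ _]/(inlW _).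
    by rewrite -[ring_tensor_inr _ _ (_ ^+ p)]/(inrW _) rmorphM !rmorphXn mulrAC.
  rewrite Heb He Hr mulr_suml; apply: eq_bigr => y _.
  rewrite pureE relative_frobenius_inr exprMn -[ring_tensor_inl _ _ _]/(inlW _).
  by rewrite -[ring_tensor_inr _ _ (_ * _)]/(inrW _) rmorphM !rmorphXn mulrA.
- by move=> _ /mapP[y _ ->]; exists (sigma y.1).
Qed.

End RelativeFrobenius.

(** * Principal ideals, torsion and layers *)

(** [ideal_gen] is an intersection of ideals; this explicit form reduces equality of principal
    ideals to divisibility of generators. *)
Definition generated_by (A : comPzRingType) (I : ideal A) (a : A) : Prop :=
  forall x, ideal_set I x <-> exists y, x = y * a.

Section PrincipalIdeals.
Variable A : comPzRingType.
Implicit Types (I J : ideal A) (a b x : A).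

Lemma mem_ideal_gen (X : set A) x : X x -> ideal_set (ideal_gen X) x.
Proof. by move=> Xx J [_]; apply. Qed.

Lemma ideal_gen_sub (X : set A) I : X `<=` I -> ideal_gen X `<=` I.
Proof. by move=> XI x; apply; split=> //; exact: idealP. Qed.

Lemma multiples_is_ideal a : is_ideal [set x | exists y, x = y * a].
Proof.
split=> [|_ _ [y ->] [z ->]|b _ [y ->]]; first by exists 0; rewrite mul0r.
  by exists (y + z); rewrite mulrDl.
by exists (b * y); rewrite mulrA.
Qed.

Lemma generated_by_minimal I a : ideal_set I a ->
  I `<=` [set x | exists y, x = y * a] -> generated_by I a.
Proof.
move=> Ia Isub x; split=> [/Isub//|[y ->]].
by case: (idealP I) => _ _; apply.
Qed.

Lemma generated_by_gen a : generated_by (ideal_gen [set a]) a.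
Proof.
apply: generated_by_minimal; first exact: mem_ideal_gen.
apply: (@ideal_gen_sub _ (Ideal (multiples_is_ideal a))) => _ ->.
by exists 1; rewrite mul1r.
Qed.

Lemma principalP I : principal I <-> exists a, generated_by I a.
Proof.
split=> [[a Ia]|[a Ia]]; exists a.
  by move=> x; rewrite Ia; apply: generated_by_gen.
apply/seteqP; split=> x; first by move/Ia; move/generated_by_gen.
by move/generated_by_gen; move/Ia.
Qed.

Lemma generated_by_mul I J a b :
  generated_by I a -> generated_by J b -> generated_by (ideal_mul I J) (a * b).
Proof.
move=> Ia Jb; apply: generated_by_minimal.
  apply: mem_ideal_gen; exists a; first by apply/Ia; exists 1; rewrite mul1r.
  by exists b => //; apply/Jb; exists 1; rewrite mul1r.
apply: (@ideal_gen_sub _ (Ideal (multiples_is_ideal (a * b)))).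
move=> _ [x /Ia[y ->] [x' /Jb[y' ->] <-]].
by exists (y * y'); rewrite mulrACA.
Qed.

Lemma generated_by_exp I a n :
  generated_by I a -> generated_by (ideal_exp I n) (a ^+ n).
Proof.
move=> Ia; elim: n => [|n IHn]; first exact: generated_by_gen.
by rewrite exprS; apply: generated_by_mul.
Qed.

Lemma generated_by_eq I J a b : generated_by I a -> generated_by J b ->
  (I = J :> set A <-> (exists u, a = u * b) /\ (exists v, b = v * a)).
Proof.
move=> Ia Jb; split=> [IJ|[[u ab] [v ba]]].
  by split; [apply/Jb; rewrite -IJ; apply/Ia|apply/Ia; rewrite IJ; apply/Jb];
    exists 1; rewrite mul1r.
apply/seteqP; split=> [x /Ia[y ->]|x /Jb[y ->]].
  by apply/Jb; exists (y * u); rewrite ab mulrA.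
by apply/Ia; exists (y * v); rewrite ba mulrA.
Qed.

End PrincipalIdeals.

Lemma generated_by_ext (A B : comPzRingType) (h : {rmorphism A -> B}) I a :
  generated_by I a -> generated_by (ideal_ext h I) (h a).
Proof.
move=> Ia; apply: generated_by_minimal.
  by apply: mem_ideal_gen; exists a => //; apply/Ia; exists 1; rewrite mul1r.
apply: (@ideal_gen_sub _ _ (Ideal (multiples_is_ideal (h a)))).
by move=> _ [_ /Ia[y ->] <-]; exists (h y); rewrite rmorphM.
Qed.

Section QuotientLift.
Variables (A B : comPzRingType) (I : ideal A) (h : {rmorphism A -> B}).
Hypothesis hI : forall x, ideal_set I x -> h x = 0.

Definition quot_lift of (forall x, ideal_set I x -> h x = 0) : quot I -> B :=
  fun x => h (repr x).

Local Notation lift := (quot_lift hI).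

Lemma quot_liftE x : lift (quot_proj I x) = h x.
Proof.
apply/eqP; rewrite -subr_eq0 -rmorphB; apply/eqP/hI/quot_projP.
exact: quot_reprK.
Qed.

Lemma quot_lift_zmod_morphism : zmod_morphism lift.
Proof.
move=> x y; rewrite -[x]quot_reprK -[y]quot_reprK -raddfB !quot_liftE.
exact: rmorphB.
Qed.

HB.instance Definition _ :=
  GRing.isZmodMorphism.Build (quot I) B lift quot_lift_zmod_morphism.

Lemma quot_lift_monoid_morphism : monoid_morphism lift.
Proof.
split=> [|x y]; first by rewrite -(rmorph1 (quot_proj I)) quot_liftE rmorph1.
rewrite -[x]quot_reprK -[y]quot_reprK -rmorphM !quot_liftE.
exact: rmorphM.
Qed.

HB.instance Definition _ :=
  GRing.isMonoidMorphism.Build (quot I) B lift quot_lift_monoid_morphism.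

End QuotientLift.

Lemma quot_proj_eq0 (A : comPzRingType) (I : ideal A) x :
  quot_proj I x = 0 <-> ideal_set I x.
Proof.
by rewrite -[X in ideal_set I X]subr0 -quot_projP raddf0.
Qed.

Section BoundedTorsion.
Variables (R A : comPzRingType) (h : {rmorphism R -> A}) (I : ideal R) (a : R).
Hypothesis Ia : generated_by I a.

Local Notation tor := (torsion I (restrict_scalars h)).

Lemma torsionP x : tor x <-> exists2 n, (0 < n)%N & h a ^+ n * x = 0.
Proof.
split=> [/(_ a)[|n n0 xn]|[n n0 xn] _ /Ia[y ->]].
- by apply/Ia; exists 1; rewrite mul1r.
- by exists n => //; rewrite -rmorphXn.
- exists n => //.
  by rewrite restrict_scaleE exprMn rmorphM -[LHS]mulrA [h (a ^+ n)]rmorphXn xn mulr0.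
Qed.

Hypothesis bounded : forall b x, ideal_set I b -> tor x -> h b * x = 0.

Lemma torsion_annihilatorP x : tor x <-> h a * x = 0.
Proof.
split=> [|xa]; first by apply: bounded; apply/Ia; exists 1; rewrite mul1r.
by apply/torsionP; exists 1%N.
Qed.

(** If x = w a is torsion, then a^2 w = 0, so w is torsion, hence already killed by a, and x = 0. *)
Lemma torsion_modulo_eq0 x : tor x -> modulo_proj h I x = 0 -> x = 0.
Proof.
move=> /torsion_annihilatorP xa /quot_proj_eq0/(generated_by_ext h Ia)[w xE].
rewrite xE mulrC; apply/torsion_annihilatorP/torsionP; exists 2 => //.
by rewrite expr2 -mulrA [h a * w]mulrC -xE.
Qed.

End BoundedTorsion.

(** * Quotients commute with base change: (A (x) S) / I = (A / I) (x) S *)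

Section LayerBaseChange.
Variables (R S A : comPzRingType) (t : {rmorphism R -> A}) (f : {rmorphism R -> S}).
(** The structure map is kept abstract because in a tower it arises by recursion and agrees with
    [ring_tensor_inr] only pointwise. *)
Variables (t' : {rmorphism S -> ring_tensor t f}) (I : ideal R) (a : R).
Hypothesis t'E : forall s, t' s = ring_tensor_inr t f s.
Hypothesis Ia : generated_by I a.

Let g : {rmorphism R -> modulo t I} := modulo_proj t I \o t.
Local Notation D' := (modulo t' (ideal_ext f I)).
Local Notation E := (ring_tensor g f).

Let ga : g a = 0.
Proof.
apply/quot_proj_eq0/(generated_by_ext t Ia).
by exists 1; rewrite mul1r.
Qed.

Let fIa : generated_by (ideal_ext t' (ideal_ext f I)) (ring_tensor_inl t f (t a)).
Proof.
by rewrite ring_tensor_glue -t'E; do 2! apply: generated_by_ext.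
Qed.

Lemma tensor_layer_glue r :
  (ring_tensor_inl g f \o modulo_proj t I) (t r) = ring_tensor_inr g f (f r).
Proof. by rewrite -ring_tensor_glue. Qed.

Definition tensor_layer : {rmorphism ring_tensor t f -> E} :=
  ring_tensor_lift tensor_layer_glue.

Lemma tensor_layer_pure (x : restrict_scalars t) (s : restrict_scalars f) :
  tensor_layer (pure x s) =
  ring_tensor_inl g f (modulo_proj t I x) * ring_tensor_inr g f s.
Proof. exact: ring_tensor_lift_pure. Qed.

Lemma tensor_layer_inl x :
  tensor_layer (ring_tensor_inl t f x) = ring_tensor_inl g f (modulo_proj t I x).
Proof. exact: ring_tensor_lift_inl. Qed.

Lemma tensor_layer_inr s :
  tensor_layer (ring_tensor_inr t f s) = ring_tensor_inr g f s.
Proof. exact: ring_tensor_lift_inr. Qed.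

Lemma tensor_layer_ideal x :
  ideal_set (ideal_ext t' (ideal_ext f I)) x -> tensor_layer x = 0.
Proof.
move=> /fIa[y ->]; rewrite rmorphM /= tensor_layer_inl.
by rewrite -[modulo_proj t I (t a)]/(g a) ga rmorph0 mulr0.
Qed.

Definition layer_to_tensor : {rmorphism D' -> E} := quot_lift tensor_layer_ideal.

Lemma layer_to_tensorE x :
  layer_to_tensor (modulo_proj t' (ideal_ext f I) x) = tensor_layer x.
Proof. exact: quot_liftE. Qed.

Lemma layer_inl_ideal x : ideal_set (ideal_ext t I) x ->
  (modulo_proj t' (ideal_ext f I) \o ring_tensor_inl t f) x = 0.
Proof.
move=> /(generated_by_ext t Ia)[y ->]; apply/quot_proj_eq0/fIa.
by exists (ring_tensor_inl t f y); rewrite rmorphM.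
Qed.

Definition layer_inl : {rmorphism modulo t I -> D'} := quot_lift layer_inl_ideal.

Lemma layer_inlE x :
  layer_inl (modulo_proj t I x) =
  modulo_proj t' (ideal_ext f I) (ring_tensor_inl t f x).
Proof. exact: quot_liftE. Qed.

Lemma tensor_to_layer_glue r :
  layer_inl (g r) = (modulo_proj t' (ideal_ext f I) \o ring_tensor_inr t f) (f r).
Proof. by rewrite layer_inlE ring_tensor_glue. Qed.

Definition tensor_to_layer : {rmorphism E -> D'} :=
  ring_tensor_lift tensor_to_layer_glue.

Lemma tensor_to_layer_inl y :
  tensor_to_layer (ring_tensor_inl g f y) = layer_inl y.
Proof. exact: ring_tensor_lift_inl. Qed.

Lemma tensor_to_layer_inr s :
  tensor_to_layer (ring_tensor_inr g f s) =
  modulo_proj t' (ideal_ext f I) (ring_tensor_inr t f s).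
Proof. exact: ring_tensor_lift_inr. Qed.

Lemma layer_to_tensorK : cancel layer_to_tensor tensor_to_layer.
Proof.
move=> x; rewrite -[x]quot_reprK; move: (repr x) => {}x.
rewrite -[quot_proj _ x]/(modulo_proj t' (ideal_ext f I) x) layer_to_tensorE.
apply: (@ring_tensor_ext _ _ _ _ _ _ (tensor_to_layer \o tensor_layer)) => [y|s].
  by rewrite /= tensor_layer_inl tensor_to_layer_inl layer_inlE.
by rewrite /= tensor_layer_inr tensor_to_layer_inr.
Qed.

Lemma tensor_to_layerK : cancel tensor_to_layer layer_to_tensor.
Proof.
apply: (@ring_tensor_ext _ _ _ _ _ _ (layer_to_tensor \o tensor_to_layer) idfun) => [y|s];
  rewrite -[LHS]/(layer_to_tensor (tensor_to_layer _)).
  rewrite tensor_to_layer_inl -[y]quot_reprK layer_inlE layer_to_tensorE.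
  exact: tensor_layer_inl.
by rewrite tensor_to_layer_inr layer_to_tensorE tensor_layer_inr.
Qed.

End LayerBaseChange.

(** * Base change of towers *)

Section MulAdditive.
Variables (A : comPzRingType) (c : A).

(** Packaged as an additive map so that [flat_kernel] yields annihilators in a base change. *)
Definition mul_by (x : A) : A := c * x.

Lemma mul_by_zmod_morphism : zmod_morphism mul_by.
Proof. by move=> x y; rewrite /mul_by mulrBr. Qed.

HB.instance Definition _ := GRing.isZmodMorphism.Build A A mul_by mul_by_zmod_morphism.

End MulAdditive.

(** * Kernels and images under flat base change *)

Section RingTensorKernel.
Variables (R S B B' : comPzRingType) (f : {rmorphism R -> S}).
Variables (g : {rmorphism R -> B}) (g' : {rmorphism R -> B'}).
Variables (h : {rmorphism B -> B'}) (hg : forall r, h (g r) = g' r).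
Hypothesis fflat : flat f.

Lemma base_change_glue r :
  (ring_tensor_inl g' f \o h) (g r) = ring_tensor_inr g' f (f r).
Proof. by rewrite /= hg ring_tensor_glue. Qed.

Definition base_change : {rmorphism ring_tensor g f -> ring_tensor g' f} :=
  ring_tensor_lift base_change_glue.

Lemma base_change_pure (b : restrict_scalars g) (s : restrict_scalars f) :
  base_change (pure b s) = ring_tensor_inl g' f (h b) * ring_tensor_inr g' f s.
Proof. exact: ring_tensor_lift_pure. Qed.

Lemma base_change_inl b : base_change (ring_tensor_inl g f b) = ring_tensor_inl g' f (h b).
Proof. exact: ring_tensor_lift_inl. Qed.

Lemma base_change_inr s : base_change (ring_tensor_inr g f s) = ring_tensor_inr g' f s.
Proof. exact: ring_tensor_lift_inr. Qed.

Lemma base_change_kernel x : base_change x = 0 ->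
  exists t : seq (B * S), (forall y, y \in t -> h y.1 = 0) /\
  x = \sum_(y <- t) pure (y.1 : restrict_scalars g) (y.2 : restrict_scalars f).
Proof.
move=> x0; have [r xE] := pure_sumP x; rewrite xE.
apply: (@flat_kernel _ _ _ _ f g g' h _ r (fun y => y.1) (fun y => y.2)) => // [b y|].
  by rewrite /= rmorphM hg.
rewrite -[RHS]x0 xE [RHS]rmorph_sum; apply: eq_bigr => y _.
by rewrite [RHS]base_change_pure pureE.
Qed.

Lemma base_change_inj : injective h -> injective base_change.
Proof.
move=> hinj; apply: raddf_inj => x /base_change_kernel[t [ht ->]].
rewrite big_seq big1 // => y yt.
have -> : y.1 = 0 by apply: hinj; rewrite ht ?rmorph0.
exact: pure0l.
Qed.

Lemma base_change_surj : (forall y, exists x, h x = y) ->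
  forall y, exists x, base_change x = y.
Proof.
move=> hsurj y; elim/tensor_ind: y => [|_ _ [x <-] [x' <-]|b s].
- by exists 0; rewrite rmorph0.
- by exists (x + x'); rewrite rmorphD.
- have [c <-] := hsurj b; exists (ring_tensor_inl g f c * ring_tensor_inr g f s).
  by rewrite rmorphM /= base_change_inl base_change_inr pureE.
Qed.

End RingTensorKernel.

(** * Layers and Frobenius projections of the base-changed tower *)

Section TowerBaseChange.
Variables (p : nat) (R S : comPzRingType) (I0 : ideal R) (T : tower).
Variables (e : {rmorphism R -> T 0%N}) (f : {rmorphism R -> S}) (a : R).
Hypotheses (p_prime : prime p) (I0a : generated_by I0 a) (I0p : ideal_set I0 p%:R).
Hypotheses (fflat : flat f) (mulflat : flat (@mul_map R S f)).
Hypothesis layer_map_inj : forall i, injective (@layer_map R I0 T e i).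
Variable F : forall i, {rmorphism layer I0 e i.+1 -> layer I0 e i}.
Hypothesis layer_mapF : forall i x, layer_map I0 e i (F i x) = x ^+ p.
Hypothesis F_surj : forall i y, exists x, F i x = y.

Local Notation t i := (tower_struct e i).
Local Notation S' := (tower_tensor e f).
Local Notation e' := (tower_tensor_base e f).
Local Notation I0' := (ideal_ext f I0).
Local Notation inl i := (ring_tensor_inl (t i) f).
Local Notation inr i := (ring_tensor_inr (t i) f).

Lemma tower_tensor_structE i s : tower_struct e' i s = inr i s.
Proof.
elim: i => [//|i IHi]; rewrite [LHS]/= IHi.
by rewrite [LHS]ring_tensor_map_pure /restrict_map rmorph1.
Qed.

Lemma tower_tensor_map_inl i x :
  tower_map S' i (inl i x) = inl i.+1 (tower_map T i x).
Proof. exact: ring_tensor_map_pure. Qed.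

Lemma tower_tensor_map_inr i s : tower_map S' i (inr i s) = inr i.+1 s.
Proof. by rewrite [LHS]ring_tensor_map_pure /restrict_map rmorph1. Qed.

Lemma tower_tensor_from1_inl i c :
  tower_from1 S' i (inl 1 c) = inl i.+1 (tower_from1 T i c).
Proof.
elim: i => [//|i IHi].
rewrite -[LHS]/(tower_map S' i.+1 (tower_from1 S' i (inl 1 c))) IHi.
exact: tower_tensor_map_inl.
Qed.

Lemma layer_map_proj (R0 : comPzRingType) (I : ideal R0) (T0 : tower)
    (e0 : {rmorphism R0 -> T0 0%N}) i x :
  layer_map I e0 i (layer_proj I e0 i x) = layer_proj I e0 i.+1 (tower_map T0 i x).
Proof. exact: modulo_mapE. Qed.

Definition tower_residue i : {rmorphism R -> layer I0 e i} := layer_proj I0 e i \o t i.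

Local Notation g i := (tower_residue i).
Local Notation E i := (ring_tensor (g i) f).

(** The layers in question are quotients of tensor products, whereas flatness acts on [E i], a
    tensor product with a quotient; the maps are built on [E i] and transported along this
    isomorphism. *)
Definition to_tensor i : {rmorphism layer I0' e' i -> E i} :=
  layer_to_tensor (@tower_tensor_structE i) I0a.

Definition from_tensor i : {rmorphism E i -> layer I0' e' i} :=
  tensor_to_layer (@tower_tensor_structE i) I0a.

Lemma to_tensorK i : cancel (to_tensor i) (from_tensor i).
Proof. exact: layer_to_tensorK. Qed.

Lemma from_tensorK i : cancel (from_tensor i) (to_tensor i).
Proof. exact: tensor_to_layerK. Qed.

Definition residue i : {rmorphism S' i -> E i} := tensor_layer (t i) f I0.

Lemma to_tensorE i x : to_tensor i (layer_proj I0' e' i x) = residue i x.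
Proof. exact: layer_to_tensorE. Qed.

Lemma residue_pure i (x : restrict_scalars (t i)) (s : restrict_scalars f) :
  residue i (pure x s) =
  ring_tensor_inl (g i) f (layer_proj I0 e i x) * ring_tensor_inr (g i) f s.
Proof. exact: tensor_layer_pure. Qed.

Lemma residue_inl i x :
  residue i (inl i x) = ring_tensor_inl (g i) f (layer_proj I0 e i x).
Proof. exact: tensor_layer_inl. Qed.

Lemma residue_inr i s : residue i (inr i s) = ring_tensor_inr (g i) f s.
Proof. exact: tensor_layer_inr. Qed.

Lemma layer_map_residue i r : layer_map I0 e i (g i r) = g i.+1 r.
Proof. exact: modulo_mapE. Qed.

Lemma layer_p i : p%:R = 0 :> layer I0 e i.
Proof.
rewrite -(rmorph_nat (layer_proj I0 e i)) -(rmorph_nat (t i)).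
have [y ->] := (I0a _).1 I0p.
apply/quot_proj_eq0/(generated_by_ext (t i) I0a).
by exists (t i y); rewrite rmorphM.
Qed.

Definition tensor_map_layer i : {rmorphism E i -> E i.+1} :=
  base_change f (@layer_map_residue i).

Lemma tensor_map_layer_inj i : injective (tensor_map_layer i).
Proof. exact: (base_change_inj fflat). Qed.

Lemma to_tensor_map i x :
  to_tensor i.+1 (layer_map I0' e' i x) = tensor_map_layer i (to_tensor i x).
Proof.
rewrite -[x]quot_reprK; move: (repr x) => {}x.
rewrite -[quot_proj _ x]/(layer_proj I0' e' i x) to_tensorE.
rewrite layer_map_proj to_tensorE.
apply: (@ring_tensor_ext _ _ _ _ _ _ (residue i.+1 \o tower_map S' i)
  (tensor_map_layer i \o residue i)) => [b|s].
  rewrite -[LHS]/(residue i.+1 (tower_map S' i _)) -[RHS]/(tensor_map_layer i (residue i _)).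
  rewrite tower_tensor_map_inl !residue_inl [RHS]base_change_inl.
  by congr ring_tensor_inl; rewrite layer_map_proj.
rewrite -[LHS]/(residue i.+1 (tower_map S' i _)) -[RHS]/(tensor_map_layer i (residue i _)).
by rewrite tower_tensor_map_inr !residue_inr [RHS]base_change_inr.
Qed.

Lemma layer_map_tensor_inj i : injective (@layer_map S I0' S' e' i).
Proof.
move=> x y /(congr1 (to_tensor i.+1)); rewrite !to_tensor_map.
by move=> /tensor_map_layer_inj /(can_inj (@to_tensorK i)).
Qed.

Local Notation twist i := (frobenius_twist p_prime (layer_p i) (g i)).
Local Notation theta i := (relative_frobenius f p_prime (layer_p i) (g i)).

(** [F i] is R-linear as a map to phi_* D_i, so that it can be base changed. This may be tested
    after the injective [layer_map], where [F i] becomes the p-th power. *)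
Lemma frobenius_proj_residue i r : F i (g i.+1 r) = twist i r.
Proof.
apply: layer_map_inj; rewrite layer_mapF /= /frobenius rmorphXn.
by rewrite layer_map_residue.
Qed.

Definition semilinear_proj i : {rmorphism E i.+1 -> ring_tensor (twist i) f} :=
  base_change f (@frobenius_proj_residue i).

Definition tensor_frobenius_proj i : {rmorphism E i.+1 -> E i} :=
  theta i \o semilinear_proj i.

Lemma tensor_frobenius_proj_inl i x : tensor_frobenius_proj i (ring_tensor_inl _ _ x) =
  ring_tensor_inl _ _ (F i x).
Proof.
by rewrite -[LHS]/(theta i (semilinear_proj i _)) [semilinear_proj i _]base_change_inl
  relative_frobenius_inl.
Qed.

Lemma tensor_frobenius_proj_inr i s : tensor_frobenius_proj i (ring_tensor_inr _ _ s) =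
  ring_tensor_inr _ _ s ^+ p.
Proof.
by rewrite -[LHS]/(theta i (semilinear_proj i _)) [semilinear_proj i _]base_change_inr
  relative_frobenius_inr.
Qed.

Lemma tensor_map_frobenius_proj i x :
  tensor_map_layer i (tensor_frobenius_proj i x) = x ^+ p.
Proof.
have pE : p%:R = 0 :> E i.+1 := rmorph_nat0 (ring_tensor_inl _ _) (layer_p i.+1).
apply: (@ring_tensor_ext _ _ _ _ _ _ (tensor_map_layer i \o tensor_frobenius_proj i)
  (frobenius p_prime pE)) => [b|s].
  rewrite -[LHS]/(tensor_map_layer i (tensor_frobenius_proj i _)).
  rewrite tensor_frobenius_proj_inl [LHS]base_change_inl layer_mapF.
  exact: rmorphXn.
rewrite -[LHS]/(tensor_map_layer i (tensor_frobenius_proj i _)).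
rewrite tensor_frobenius_proj_inr rmorphXn.
by congr (_ ^+ p); exact: base_change_inr.
Qed.

Lemma tensor_frobenius_proj_surj i y : exists x, tensor_frobenius_proj i x = y.
Proof.
have [z <-] := relative_frobenius_surj p_prime fflat mulflat (layer_p i) (g := g i) y.
by have [x <-] := base_change_surj (@frobenius_proj_residue i) (@F_surj i) z; exists x.
Qed.

(** [theta i] is injective, so the kernel is that of F_i (x) S, and flatness describes the
    latter. *)
Lemma tensor_frobenius_proj_kernel i x : tensor_frobenius_proj i x = 0 ->
  exists t : seq (layer I0 e i.+1 * S), (forall y, y \in t -> F i y.1 = 0) /\
  x = \sum_(y <- t) pure (y.1 : restrict_scalars (g i.+1)) (y.2 : restrict_scalars f).
Proof.
move=> /(relative_frobenius_eq0 fflat mulflat) Fx.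
exact: (base_change_kernel fflat Fx).
Qed.

Definition layer_frobenius_proj i : {rmorphism layer I0' e' i.+1 -> layer I0' e' i} :=
  from_tensor i \o tensor_frobenius_proj i \o to_tensor i.+1.

Lemma layer_frobenius_projE i x :
  layer_frobenius_proj i x = from_tensor i (tensor_frobenius_proj i (to_tensor i.+1 x)).
Proof. by []. Qed.

Lemma layer_map_frobenius_proj i x :
  layer_map I0' e' i (layer_frobenius_proj i x) = x ^+ p.
Proof.
apply: (can_inj (@to_tensorK i.+1)); rewrite to_tensor_map layer_frobenius_projE.
by rewrite from_tensorK tensor_map_frobenius_proj rmorphXn.
Qed.

Lemma layer_frobenius_proj_surj i y : exists x, layer_frobenius_proj i x = y.
Proof.
have [x xy] := tensor_frobenius_proj_surj (to_tensor i y).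
exists (from_tensor i.+1 x).
by rewrite layer_frobenius_projE from_tensorK xy to_tensorK.
Qed.

Lemma tensor_frobenius_proj_eq0 i k :
  (forall d, F i d = 0 <-> exists w, d = w * k) ->
  forall x, tensor_frobenius_proj i x = 0 <->
    exists w, x = w * ring_tensor_inl (g i.+1) f k.
Proof.
move=> Fk x; split=> [/tensor_frobenius_proj_kernel[r [Fr ->]]|[w ->]]; last first.
  rewrite rmorphM [X in _ * X]tensor_frobenius_proj_inl.
  by rewrite (proj2 (Fk k)) ?rmorph0 ?mulr0 //; exists 1; rewrite mul1r.
rewrite big_seq; elim/big_ind: _ => [|_ _ [w ->] [w' ->]|y /Fr/Fk[w wk]].
- by exists 0; rewrite mul0r.
- by exists (w + w'); rewrite mulrDl.
- exists (pure (w : restrict_scalars (g i.+1)) (y.2 : restrict_scalars f)).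
  by rewrite !pureE wk rmorphM mulrAC.
Qed.

Lemma layer_frobenius_proj_eq0 i c :
  (forall d, F i d = 0 <-> exists w, d = w * layer_proj I0 e i.+1 (tower_from1 T i c)) ->
  forall x, layer_frobenius_proj i x = 0 <->
    exists w, x = w * layer_proj I0' e' i.+1 (tower_from1 S' i (inl 1%N c)).
Proof.
move=> Fc x; rewrite layer_frobenius_projE tower_tensor_from1_inl.
have kE : to_tensor i.+1 (layer_proj I0' e' i.+1 (inl i.+1 (tower_from1 T i c))) =
    ring_tensor_inl (g i.+1) f (layer_proj I0 e i.+1 (tower_from1 T i c)).
  by rewrite to_tensorE residue_inl.
split=> [Fx|[w ->]].
  have /(tensor_frobenius_proj_eq0 Fc)[w wx] :
      tensor_frobenius_proj i (to_tensor i.+1 x) = 0.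
    by rewrite -[LHS]from_tensorK Fx rmorph0.
  exists (from_tensor i.+1 w); apply: (can_inj (@to_tensorK i.+1)).
  by rewrite rmorphM kE from_tensorK.
rewrite rmorphM kE (proj2 (tensor_frobenius_proj_eq0 Fc _)) ?rmorph0 //.
by exists (to_tensor i.+1 w).
Qed.

(** * Torsion in the base-changed tower *)

Local Notation tor i := (@layer_torsion R I0 T e i).
Local Notation tor' i := (@layer_torsion S I0' S' e' i).

Hypothesis bounded : forall i b x, ideal_set I0 b -> tor i x -> t i b * x = 0.
Variable Ftor : forall i, T i.+1 -> T i.
Hypothesis Ftor_bij : forall i, set_bij (tor i.+1) (tor i) (@Ftor i).
Hypothesis FtorE : forall i x, tor i.+1 x ->
  F i (layer_proj I0 e i.+1 x) = layer_proj I0 e i (Ftor x).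

Lemma layer_torsionP i x : tor i x <-> t i a * x = 0.
Proof. exact: (torsion_annihilatorP I0a (@bounded i)). Qed.

Lemma layer_torsion_eq0 i x : tor i x -> layer_proj I0 e i x = 0 -> x = 0.
Proof. exact: (torsion_modulo_eq0 I0a (@bounded i)). Qed.

Lemma layer_torsionM i x y : tor i x -> tor i (y * x).
Proof. by move=> /layer_torsionP tx; apply/layer_torsionP; rewrite mulrCA tx mulr0. Qed.

Lemma layer_torsionD i x y : tor i x -> tor i y -> tor i (x + y).
Proof.
by move=> /layer_torsionP tx /layer_torsionP ty; apply/layer_torsionP; rewrite mulrDr tx ty addr0.
Qed.

Lemma layer_torsion0 i : tor i 0.
Proof. by apply/layer_torsionP; rewrite mulr0. Qed.

(** [Ftor] is not assumed additive. Torsion injects into the layer, however, which forces both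
    [Ftor x = 0] and [Ftor 0 = 0]; injectivity of [Ftor] concludes. *)
Lemma frobenius_proj_torsion_eq0 i x :
  tor i.+1 x -> F i (layer_proj I0 e i.+1 x) = 0 -> x = 0.
Proof.
have [Ffun Finj _] := @Ftor_bij i => tx; rewrite FtorE // => Fx.
have t0 := layer_torsion0 i.+1.
apply: Finj; rewrite ?inE //.
rewrite (layer_torsion_eq0 (Ffun _ tx) Fx); apply/esym/layer_torsion_eq0; first exact: Ffun.
by rewrite -FtorE // !rmorph0.
Qed.

(** A torsion element is killed by some power of the generator [a]; [flat_kernel] for multiplication
    by that power moves the annihilation to the first components. *)
Lemma tensor_torsion_sum i x : tor' i x ->
  exists s : seq (T i * S), (forall y, y \in s -> tor i y.1) /\
  x = \sum_(y <- s) pure (y.1 : restrict_scalars (t i)) (y.2 : restrict_scalars f).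
Proof.
move=> /(torsionP (generated_by_ext f I0a))[n n_gt0].
rewrite tower_tensor_structE -ring_tensor_glue => xn.
have [r xE] := pure_sumP x; rewrite xE.
have [| |s [sn ->]] := @flat_kernel _ _ _ _ f (t i) (t i) (mul_by (t i a ^+ n)) _ r
  (fun y => y.1) (fun y => y.2) fflat.
- by move=> b y; rewrite /= /mul_by mulrCA.
- rewrite -[RHS]xn xE mulr_sumr; apply: eq_bigr => y _.
  by rewrite !pureE /= /mul_by rmorphM rmorphXn mulrA.
- by exists s; split=> // y /sn ys; apply/(torsionP I0a); exists n.
Qed.

Lemma tensor_torsion_annihilated i x : tor' i x -> inl i (t i a) * x = 0.
Proof.
move=> /tensor_torsion_sum[s [sn ->]]; rewrite mulr_sumr big_seq big1 // => y /sn.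
by move=> /layer_torsionP ya; rewrite pureE mulrA -rmorphM ya rmorph0 mul0r.
Qed.

Lemma tensor_bounded i b x :
  ideal_set I0' b -> tor' i x -> tower_struct e' i b * x = 0.
Proof.
move=> /(generated_by_ext f I0a)[y ->] /tensor_torsion_annihilated xa.
by rewrite rmorphM -mulrA [X in _ * (X * _)]tower_tensor_structE -ring_tensor_glue xa mulr0.
Qed.

Lemma tensor_torsionP i x : tor' i x <-> inl i (t i a) * x = 0.
Proof.
rewrite ring_tensor_glue -tower_tensor_structE.
exact: (torsion_annihilatorP (generated_by_ext f I0a) (@tensor_bounded i)).
Qed.

Lemma tensor_torsionD i x y : tor' i x -> tor' i y -> tor' i (x + y).
Proof.
move=> /tensor_torsionP tx /tensor_torsionP ty; apply/tensor_torsionP.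
by rewrite mulrDr tx ty addr0.
Qed.

Lemma tensor_torsionB i x y : tor' i x -> tor' i y -> tor' i (x - y).
Proof.
move=> /tensor_torsionP tx /tensor_torsionP ty; apply/tensor_torsionP.
by rewrite mulrBr tx ty subr0.
Qed.

Lemma tensor_torsion0 i : tor' i 0.
Proof. by apply/tensor_torsionP; rewrite mulr0. Qed.

Lemma tensor_torsion_pure i x s : tor i x ->
  tor' i (pure (x : restrict_scalars (t i)) (s : restrict_scalars f)).
Proof.
move=> /layer_torsionP tx; apply/tensor_torsionP.
by rewrite pureE mulrA -rmorphM tx rmorph0 mul0r.
Qed.

Lemma tensor_torsion_residue_eq0 i x : tor' i x -> residue i x = 0 -> x = 0.
Proof.
move=> tx rx; apply: (torsion_modulo_eq0 (generated_by_ext f I0a) (@tensor_bounded i)) => //.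
by apply: (can_inj (@to_tensorK i)); rewrite [LHS]to_tensorE rx rmorph0.
Qed.

Lemma tensor_torsion_residue_inj i x y :
  tor' i x -> tor' i y -> residue i x = residue i y -> x = y.
Proof.
move=> tx ty xy; apply/subr0_eq/tensor_torsion_residue_eq0; first exact: tensor_torsionB.
by rewrite raddfB /= xy subrr.
Qed.

(** After removing the injective [theta i], the inverse assignment F_i z (x) s |-> z (x) s for
    torsion z is well defined, because F_i is injective on torsion; [flat_lift] applies it to the
    vanishing image and returns x = 0. *)
Lemma tensor_torsion_proj_eq0 i x :
  tor' i.+1 x -> tensor_frobenius_proj i (residue i.+1 x) = 0 -> x = 0.
Proof.
move=> /tensor_torsion_sum[s [tors ->]] /(relative_frobenius_eq0 fflat mulflat) Fx.
pose G (v : restrict_scalars (twist i)) (b : S -> ring_tensor (t i.+1) f) :=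
  exists z, [/\ tor i.+1 z, v = F i (layer_proj I0 e i.+1 z) &
    forall s, b s = pure (z : restrict_scalars (t i.+1)) (s : restrict_scalars f)].
have := @flat_lift _ _ f (restrict_scalars (twist i)) _ [set 0] G fflat _ _ _ _ _ _ _ _
  s (fun y => F i (layer_proj I0 e i.+1 y.1))
  (fun y s => pure (y.1 : restrict_scalars (t i.+1)) (s : restrict_scalars f)) (fun y => y.2).
apply=> //.
- by move=> _ _ -> ->; rewrite /= subrr.
- exists 0; split; [exact: layer_torsion0|by rewrite !rmorph0|].
  by move=> u; rewrite pure0l.
- move=> v v' b b' [z [tz -> bz]] [z' [tz' -> bz']]; exists (z + z').
  split; [exact: layer_torsionD|by rewrite !rmorphD|].
  by move=> u; rewrite bz bz' pureDl.
- move=> r v b [z [tz -> bz]]; exists (t i.+1 r * z).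
  split; [exact: layer_torsionM| |].
    by rewrite restrict_scaleE -frobenius_proj_residue !rmorphM.
  by move=> u; rewrite bz -!restrict_scaleE pureZ.
- by move=> v b [z [_ _ bz]] u u'; rewrite !bz !pureE raddfB mulrBr.
- move=> b u [z [tz Fz bz]]; rewrite /= bz.
  by rewrite (frobenius_proj_torsion_eq0 tz (esym Fz)) pure0l.
- by move=> y /tors ty; exists y.1.
- rewrite -[RHS]Fx [residue _ _]rmorph_sum [RHS]rmorph_sum; apply: eq_bigr => y _.
  rewrite residue_pure rmorphM [semilinear_proj i _]base_change_inl.
  by rewrite [semilinear_proj i _]base_change_inr pureE.
Qed.

Lemma tensor_torsion_proj_exists i x : tor' i.+1 x ->
  exists y, tor' i y /\ tensor_frobenius_proj i (residue i.+1 x) = residue i y.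
Proof.
move=> /tensor_torsion_sum[s [tors ->]]; rewrite big_seq.
elim/big_ind: _ => [|x1 x2 [y1 [t1 E1]] [y2 [t2 E2]]|z /tors tz].
- by exists 0; split; [exact: tensor_torsion0|rewrite !rmorph0].
- by exists (y1 + y2); split; [exact: tensor_torsionD|rewrite !rmorphD E1 E2].
- have [Ffun _ _] := @Ftor_bij i.
  (* The second component is raised to the p-th power because the projection acts as Frobenius on
     S. *)
  exists (pure (Ftor z.1 : restrict_scalars (t i)) (z.2 ^+ p : restrict_scalars f)).
  split; first exact/tensor_torsion_pure/Ffun.
  rewrite !residue_pure rmorphM [X in X * _]tensor_frobenius_proj_inl.
  by rewrite [X in _ * X]tensor_frobenius_proj_inr FtorE // rmorphXn.
Qed.

(** The image of torsion under the projection contains only p-th powers in its second factors, as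
    does [theta i n]; a first factor d of n is absorbed into y, which stays torsion. *)
Lemma torsion_relative_frobenius i y (n : ring_tensor (twist i) f) : tor i y ->
  exists x, tor' i.+1 x /\ tensor_frobenius_proj i (residue i.+1 x) =
    ring_tensor_inl (g i) f (layer_proj I0 e i y) * theta i n.
Proof.
move=> ty; elim/tensor_ind: n => [|n1 n2 [x1 [t1 E1]] [x2 [t2 E2]]|d s].
- by exists 0; split; [exact: tensor_torsion0|rewrite !rmorph0 mulr0].
- exists (x1 + x2); split; first exact: tensor_torsionD.
  by rewrite !rmorphD E1 E2 mulrDr.
- have [_ _ Fsurj] := @Ftor_bij i.
  (* [repr d] lifts d from the layer to the ring of the tower. *)
  have [x tx xE] := Fsurj _ (layer_torsionM (repr (d : layer I0 e i)) ty).
  exists (pure (x : restrict_scalars (t i.+1)) (s : restrict_scalars f)).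
  split; first exact: tensor_torsion_pure.
  rewrite residue_pure rmorphM [X in X * _]tensor_frobenius_proj_inl.
  rewrite [X in _ * X]tensor_frobenius_proj_inr FtorE // xE.
  rewrite pureE [theta i _]rmorphM relative_frobenius_inl relative_frobenius_inr.
  rewrite mulrA -[in RHS]rmorphM; congr (ring_tensor_inl _ _ _ * _).
  by rewrite rmorphM mulrC; congr (_ * _); exact: quot_reprK.
Qed.

Lemma tensor_torsion_proj_surj i y : tor' i y ->
  exists x, tor' i.+1 x /\ tensor_frobenius_proj i (residue i.+1 x) = residue i y.
Proof.
move=> /tensor_torsion_sum[s [tors ->]]; rewrite big_seq.
elim/big_ind: _ => [|y1 y2 [x1 [t1 E1]] [x2 [t2 E2]]|z /tors tz].
- by exists 0; split; [exact: tensor_torsion0|rewrite !rmorph0].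
- by exists (x1 + x2); split; [exact: tensor_torsionD|rewrite !rmorphD E1 E2].
(* Surjectivity of the relative Frobenius writes 1 (x) s as [theta i n], so y (x) s takes the form
   of the preceding lemma. *)
- have [n nz] := relative_frobenius_surj p_prime fflat mulflat (layer_p i)
    (ring_tensor_inr (g i) f z.2).
  have [x [tx xE]] := torsion_relative_frobenius n tz.
  by exists x; split=> //; rewrite xE nz residue_pure.
Qed.

Lemma tensor_torsion_bij i : exists Ftor' : S' i.+1 -> S' i,
  set_bij (tor' i.+1) (tor' i) Ftor' /\
  forall x, tor' i.+1 x ->
    layer_frobenius_proj i (layer_proj I0' e' i.+1 x) = layer_proj I0' e' i (Ftor' x).
Proof.
(* The map is chosen pointwise, with default value 0 off the torsion; additivity is recovered only
   through residues. *)
have /choice[h hP] : forall x, exists y, tor' i.+1 x ->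
    tor' i y /\ tensor_frobenius_proj i (residue i.+1 x) = residue i y.
  move=> x; have [/tensor_torsion_proj_exists[y yP]|ntx] := pselect (tor' i.+1 x).
    by exists y.
  by exists 0.
exists h; split; last first.
  move=> x /hP[_ hx]; apply: (can_inj (@to_tensorK i)).
  by rewrite layer_frobenius_projE from_tensorK !to_tensorE.
split=> [x /hP[]//|x x' /[!inE] tx tx' hxx'|y ty].
  apply/subr0_eq/tensor_torsion_proj_eq0; first exact: tensor_torsionB.
  have [_ hx] := hP _ tx; have [_ hx'] := hP _ tx'.
  by rewrite [residue _ _]raddfB raddfB [X in X - _]hx [X in _ - X]hx' hxx' subrr.
have [x [tx xy]] := tensor_torsion_proj_surj ty.
exists x => //; have [thx hx] := hP _ tx.
by apply: tensor_torsion_residue_inj => //; rewrite -hx.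
Qed.

End TowerBaseChange.

(** * The zeroth layer and the verification of the axioms *)

Lemma tower_tensor_base_bij (R S : comPzRingType) (T : tower)
    (e : {rmorphism R -> T 0%N}) (f : {rmorphism R -> S}) :
  bijective e -> bijective (tower_tensor_base e f).
Proof.
case=> e1 eK e1K.
pose b (x : restrict_scalars e) (s : restrict_scalars f) : S := f (e1 x) * s.
(* [e1] is given only as an inverse function, so its ring laws are transported from [e]. *)
have e1D x y : e1 (x + y) = e1 x + e1 y.
  by apply: (can_inj eK); rewrite rmorphD !e1K.
have e1M x y : e1 (x * y) = e1 x * e1 y.
  by apply: (can_inj eK); rewrite rmorphM !e1K.
have bP : balanced b.
  split=> [x y s|x s u|r x s]; rewrite /b ?e1D ?rmorphD ?mulrDl ?mulrDr //.
  by rewrite !restrict_scaleE e1M eK rmorphM mulrCA mulrA.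
exists (tensor_lift b) => [s|x].
  rewrite [LHS](tensor_lift_pure bP) /b.
  have -> : e1 1 = 1 by rewrite -(rmorph1 e) eK.
  by rewrite rmorph1 mul1r.
elim/tensor_ind: x => [|x y IHx IHy|x s].
- by rewrite (tensor_lift0 bP) rmorph0.
- by rewrite (tensor_liftD bP) rmorphD /= IHx IHy.
- rewrite (tensor_lift_pure bP) /b rmorphM /= -[tower_tensor_base e f _]ring_tensor_glue.
  by rewrite /= e1K pureE.
Qed.

Theorem theorem3p11 (p : nat) (R S : comPzRingType) (I0 : ideal R) (T : tower)
    (e : {rmorphism R -> T 0%N}) (f : {rmorphism R -> S}) :
  prime p ->
  preperfectoid p I0 e ->
  weakly_etale f ->
  preperfectoid p (ideal_ext f I0) (tower_tensor_base e f).
Proof.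
move=> p_prime [[e_bij I0p] lmap_inj _ [F [FE F_surj [/principalP[a I0a]]]]].
move=> [I1 [/principalP[c I1c] I1p FI1]] tors [fflat mulflat].
have bounded i b x : ideal_set I0 b -> layer_torsion I0 e x ->
  tower_struct e i b * x = 0 by case: (tors i) => + _; apply.
pose Ftor i := projT1 (cid (proj2 (tors i))).
have Ftor_bij i := proj1 (projT2 (cid (proj2 (tors i)))).
have FtorE i := proj2 (projT2 (cid (proj2 (tors i)))).
pose F' := layer_frobenius_proj f p_prime I0a I0p lmap_inj FE.
have F'E := layer_map_frobenius_proj (f := f) p_prime I0a I0p lmap_inj FE.
split.
- split; first exact: tower_tensor_base_bij.
  by rewrite -(rmorph_nat f); apply: mem_ideal_gen; exists p%:R.
- exact: (layer_map_tensor_inj I0a fflat lmap_inj).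
(* The inclusion of images follows from the projection already constructed. *)
- by move=> i _ [x _ <-]; exists (F' i x) => //; exact: F'E.
exists F'; split=> //.
- by move=> i y; apply: layer_frobenius_proj_surj.
- split; first by apply/principalP; exists (f a); exact: generated_by_ext.
  pose c' := ring_tensor_inl (tower_struct e 1) f c.
  exists (ideal_gen [set c']); split; first by exists c'.
    have I1ext := generated_by_ext (tower_struct e 1) I0a.
    (* The equality of ideals becomes mutual divisibility of c^p and the image of a, which is
       carried over to the tensor product by [ring_tensor_inl]. *)
    have [[u uE] [v vE]] := (generated_by_eq (generated_by_exp p I1c) I1ext).1 I1p.
    apply/(generated_by_eq (generated_by_exp p (@generated_by_gen _ c'))
      (generated_by_ext _ (generated_by_ext f I0a))).
    rewrite tower_tensor_structE -ring_tensor_glue /c' -rmorphXn.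
    split; [exists (ring_tensor_inl _ _ u)|exists (ring_tensor_inl _ _ v)].
      by rewrite -[RHS]rmorphM -uE.
    by rewrite -[RHS]rmorphM -vE.
  move=> i.
  have Fc d : F i d = 0 <-> exists w, d = w * layer_proj I0 e i.+1 (tower_from1 T i c).
    rewrite -(generated_by_ext (layer_proj I0 e i.+1 \o tower_from1 T i) I1c d).
    by rewrite -FI1.
  apply/seteqP; split=> x.
    move=> /(layer_frobenius_proj_eq0 (f := f) p_prime I0a I0p fflat mulflat lmap_inj FE Fc) H.
    by apply/(generated_by_ext _ (@generated_by_gen _ c')).
  move=> /(generated_by_ext _ (@generated_by_gen _ c')) H.
  exact/(layer_frobenius_proj_eq0 (f := f) p_prime I0a I0p fflat mulflat lmap_inj FE Fc).
- move=> i; split; first by move=> b x; apply: (tensor_bounded I0a fflat bounded).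
  exact: (tensor_torsion_bij p_prime I0a I0p fflat mulflat lmap_inj FE bounded Ftor_bij FtorE).
Qed.
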